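(* Let $(G,u)$ be an Archimedean norm-complete dimension group with order-unit, and let $\mathfrak{d}$ be a bounded positive norm-closed interval of $G$. Then $M_{0,\mathrm{cl}}(G,\mathfrak{d})$ is cancellative and $M_{\mathrm{cl}}(G,\mathfrak{d})$ is Archimedean and norm-complete.
   Context: A partially ordered abelian group is an abelian group $G$ with a translation-invariant partial order; $G^+=\{x\in G: x\ge0\}$; $\mathbb{N}$ is the set of positive integers. An order-unit is $u\in G^+$ such that for every $x\in G$ there is $n\in\mathbb{N}$ with $x\leq nu$. $G$ is directed if any two elements have a common upper bound; unperforated if for all $m\in\mathbb{N}$ and $x\in G$, $mx\geq0$ implies $x\geq0$; $G$ has interpolation if whenever $a_0,a_1\leq b_0,b_1$ there is $c$ with $a_0,a_1\leq c\leq b_0,b_1$. A dimension group is a directed unperforated partially ordered abelian group with interpolation. $G$ is Archimedean if for all $a,b\in G$, ($na\leq b$ for all integers $n\geq0$) implies $a\leq0$. The canonical norm on $(G,u)$ is $\|x\|_u=\inf\{k/n: k\in\mathbb{Z},\,k\ge0,\ n\in\mathbb{N},\ -ku\leq nx\leq ku\}$; $(G,u)$ is norm-complete if every Cauchy sequence for $\|\cdot\|_u$ converges in $G$. An interval of $G$ is a nonempty upward directed lower subset; it is positive if it contains $0$, bounded if it has an upper bound in $G$, norm-closed if it is closed for the topology of $\|\cdot\|_u$. Intervals are added by $\mathfrak{a}+\mathfrak{b}=\{z\in G: z\leq x+y\text{ for some }x\in\mathfrak{a},\,y\in\mathfrak{b}\}$ and ordered by inclusion. $\mathbf{\Lambda}_{\mathrm{cl}}(G)$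 is the ordered monoid of norm-closed intervals (it is closed under this addition) and $\mathbf{\Lambda}_{\mathrm{cl}}(G)^+$ is its submonoid of norm-closed positive intervals. For a commutative monoid $A$ (here positively ordered) write $x\leq^+y$ if $x+z=y$ for some $z\in A$, and for $d\in A$ let $A\restriction d=\{x\in A:(\exists n\in\mathbb{N})\ x\leq^+nd\}$, a submonoid. $\mathrm{Grot}(B)$ is the Grothendieck (universal) group of a commutative monoid $B$; $[b]$ denotes the image of $b\in B$; $\mathrm{Grot}(A\restriction d)$ is partially ordered with positive cone $\{[x]:x\in A\restriction d\}$, and $[d]$ is an order-unit of it. Put $M_{0,\mathrm{cl}}(G,\mathfrak{d})=\mathbf{\Lambda}_{\mathrm{cl}}(G)^+\restriction\mathfrak{d}$ and $M_{\mathrm{cl}}(G,\mathfrak{d})=\mathrm{Grot}(\mathbf{\Lambda}_{\mathrm{cl}}(G)^+\restriction\mathfrak{d})$. Norm-completeness of $M_{\mathrm{cl}}(G,\mathfrak{d})$ is with respect to the canonical norm associated with the order-unit $[\mathfrak{d}]$. *)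

(* Defs.v *)
From HB Require Import structures.
From mathcomp Require Import all_boot all_order all_algebra.
From mathcomp Require Import boolp classical_sets reals.

Set Implicit Arguments.
Unset Strict Implicit.
Unset Printing Implicit Defensive.

Import Order.TTheory GRing.Theory Num.Theory.

Local Open Scope ring_scope.
Local Open Scope classical_set_scope.
Local Open Scope quotient_scope.

(* [Num.POrderedZmodule] has an order and a group law without any
   compatibility between them. *)
HB.mixin Record POrderedZmodule_isTransInv G & Num.POrderedZmodule G := {
  poag_leD2r : forall z x y : G, x <= y -> x + z <= y + z
}.

#[short(type="poagType")]
HB.structure Definition POAbGroup :=
  { G of Num.POrderedZmodule G & POrderedZmodule_isTransInv G }.

(* The order is a bare relation: the order classes of the library already
   have [Num.POrderedZmodule] as their join with the additive monoids. *)
HB.mixin Record isPosOrderedMonoid A & GRing.Nmodule A := {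
  pomon_le : A -> A -> Prop;
  pomon_le_refl : forall x, pomon_le x x;
  pomon_le_anti : forall x y, pomon_le x y -> pomon_le y x -> x = y;
  pomon_le_trans : forall y x z, pomon_le x y -> pomon_le y z -> pomon_le x z;
  pomon_leD2r : forall z x y, pomon_le x y -> pomon_le (x + z) (y + z);
  pomon_ge0 : forall x, pomon_le 0 x
}.

#[short(type="pomonType")]
HB.structure Definition PosOrderedMonoid :=
  { A of GRing.Nmodule A & isPosOrderedMonoid A }.

Section PoagDefs.
Variable G : poagType.
Implicit Types (u x y z a b : G).

Definition order_unit u : Prop :=
  0 <= u /\ forall x, exists2 n : nat, (0 < n)%N & x <= u *+ n.

Definition directed : Prop := forall x y, exists2 z, x <= z & y <= z.

Definition unperforated : Prop :=
  forall (m : nat) x, (0 < m)%N -> 0 <= x *+ m -> 0 <= x.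

Definition interpolation : Prop :=
  forall a0 a1 b0 b1, a0 <= b0 -> a0 <= b1 -> a1 <= b0 -> a1 <= b1 ->
  exists c, [/\ a0 <= c, a1 <= c, c <= b0 & c <= b1].

Definition dimension_group : Prop :=
  [/\ directed, unperforated & interpolation].

Definition archimedean : Prop :=
  forall a b, (forall n : nat, a *+ n <= b) -> a <= 0.

Variables (R : realType) (u : G).

Definition order_norm x : R :=
  inf [set r | exists k n : nat,
         [/\ (0 < n)%N, r = k%:R / n%:R, - (u *+ k) <= x *+ n
           & x *+ n <= u *+ k]].

Definition norm_cauchy (f : nat -> G) : Prop :=
  forall e : R, 0 < e -> exists N : nat, forall m n : nat,
    (N <= m)%N -> (N <= n)%N -> order_norm (f m - f n) < e.

Definition norm_cvg (f : nat -> G) (l : G) : Prop :=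
  forall e : R, 0 < e -> exists N : nat, forall n : nat,
    (N <= n)%N -> order_norm (f n - l) < e.

Definition norm_complete : Prop :=
  forall f, norm_cauchy f -> exists l, norm_cvg f l.

Definition norm_closed (I : set G) : Prop :=
  forall z, (forall e : R, 0 < e -> exists2 w, I w & order_norm (z - w) < e) ->
  I z.

End PoagDefs.

Arguments directed : clear implicits.
Arguments unperforated : clear implicits.
Arguments interpolation : clear implicits.
Arguments dimension_group : clear implicits.
Arguments archimedean : clear implicits.
Arguments order_norm {G} R u x.
Arguments norm_cauchy {G} R u f.
Arguments norm_cvg {G} R u f l.
Arguments norm_complete {G} R u.
Arguments norm_closed {G} R u I.

Record arch_complete_dimension_group
    (R : realType) (G : poagType) (u : G) : Prop := ArchCompleteDimensionGroup {
  acdg_dim : dimension_group G;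
  acdg_unit : order_unit u;
  acdg_arch : archimedean G;
  acdg_complete : norm_complete R u
}.

Section Intervals.
Variable G : poagType.

Definition interval (I : set G) : Prop :=
  [/\ I !=set0,
      forall x y, I x -> I y -> exists z, [/\ I z, x <= z & y <= z]
    & forall x y, x <= y -> I y -> I x].

Definition interval_bounded (I : set G) : Prop :=
  exists b, forall x, I x -> x <= b.

Definition interval_add (I J : set G) : set G :=
  [set z | exists x y, [/\ I x, J y & z <= x + y]].

Definition interval_zero : set G := [set z | z <= 0].

End Intervals.

Section PoagTheory.
Variable G : poagType.
Implicit Types x y z t : G.

Lemma poag_leD x y z t : x <= y -> z <= t -> x + z <= y + t.
Proof.
move=> xy zt; apply: (@le_trans _ _ (y + z)); first exact: poag_leD2r.
by rewrite ![y + _]addrC; exact: poag_leD2r.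
Qed.

Lemma poag_subr_ge0 x y : (0 <= y - x) = (x <= y).
Proof.
apply/idP/idP => [/(poag_leD2r x)|/(poag_leD2r (- x))].
  by rewrite add0r subrK.
by rewrite subrr.
Qed.

Lemma poag_lerBlDr x y z : (x - y <= z) = (x <= z + y).
Proof.
by rewrite -(poag_subr_ge0 _ z) -(poag_subr_ge0 x) opprB addrA.
Qed.

Lemma poag_lerBrDr x y z : (x <= y - z) = (x + z <= y).
Proof.
by rewrite -(poag_subr_ge0 x) -(poag_subr_ge0 _ y) opprD addrA addrAC.
Qed.

Lemma poag_leN x y : (- x <= - y) = (y <= x).
Proof. by rewrite -(poag_subr_ge0 (- x)) opprK addrC poag_subr_ge0. Qed.

Lemma poag_leMn n x y : x <= y -> x *+ n <= y *+ n.
Proof.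
move=> xy; elim: n => [|n IH]; first by rewrite !mulr0n.
by rewrite !mulrS; exact: poag_leD.
Qed.

Lemma poag_ge0Mn n x : 0 <= x -> 0 <= x *+ n.
Proof. by move=> /(poag_leMn n); rewrite mul0rn. Qed.

Lemma unperforated_le n x y : unperforated G -> (0 < n)%N ->
  x *+ n <= y *+ n -> x <= y.
Proof.
move=> hG n0; rewrite -(poag_subr_ge0 x) -(poag_subr_ge0 (x *+ n)) -mulrnBl.
exact: hG.
Qed.

End PoagTheory.

Section NormTheory.
Variables (R : realType) (G : poagType) (u : G).
Hypotheses (hU : unperforated G) (hu : order_unit u).
Implicit Types x y z : G.

Let S x := [set r : R | exists k n : nat,
   [/\ (0 < n)%N, r = k%:R / n%:R, - (u *+ k) <= x *+ n & x *+ n <= u *+ k]].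

Let S_lb x : lbound (S x) 0.
Proof. by move=> _ [k [n [_ -> _ _]]]; rewrite divr_ge0. Qed.

Let S_neq0 x : S x !=set0.
Proof.
have [u0 hux] := hu.
have [n n0 xn] := hux x; have [m m0 xm] := hux (- x).
exists ((n + m)%:R / 1%:R), (n + m)%N, 1%N; split=> //; rewrite mulr1n mulrnDr.
  rewrite -poag_leN opprK; apply: le_trans xm _.
  by rewrite -[leLHS]add0r poag_leD // poag_ge0Mn.
by apply: le_trans xn _; rewrite -[leLHS]addr0 poag_leD // poag_ge0Mn.
Qed.

Lemma order_norm_lt x (N : nat) : (0 < N)%N -> order_norm R u x < N%:R^-1 ->
  - u <= x *+ N /\ x *+ N <= u.
Proof.
move=> N0 /(inf_lt (S_neq0 x))[_ [k [n [n0 -> l1 l2]]]].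
rewrite ltr_pdivrMr ?ltr0n// mulrC ltr_pdivlMr ?ltr0n// -natrM ltr_nat => kN.
have uk : u *+ (k * N) <= u *+ n.
  rewrite -(subnK (ltnW kN)) mulrnDr -[leLHS]add0r.
  by apply: poag_leD => //; apply: poag_ge0Mn; case: hu.
split; apply: (unperforated_le hU n0); rewrite -mulrnA mulnC mulrnA.
  apply: le_trans (poag_leMn N l1).
  by rewrite !mulNrn poag_leN -mulrnA.
by apply: le_trans (poag_leMn N l2) _; rewrite -mulrnA.
Qed.

Lemma order_norm_le x (N : nat) : (0 < N)%N -> - u <= x *+ N -> x *+ N <= u ->
  order_norm R u x <= N%:R^-1.
Proof.
move=> N0 h1 h2; apply: ge_inf; first by exists 0; exact: S_lb.
by exists 1%N, N; rewrite mulr1n div1r.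
Qed.

Lemma small_pow2 (e : R) : 0 < e -> exists N : nat, (2 ^ N)%:R^-1 < e.
Proof.
move=> e0; have [N hN] : exists N : nat, e^-1 < N%:R.
  by exists (Num.bound e^-1); apply: archi_boundP; rewrite invr_ge0 ltW.
exists N; rewrite invf_plt ?posrE ?ltr0n ?expn_gt0//.
by apply: lt_trans hN _; rewrite ltr_nat ltn_expl.
Qed.

End NormTheory.

Section ClosedSum.
Variables (R : realType) (G : poagType) (u : G).
Hypothesis hG : arch_complete_dimension_group R u.
Implicit Types (x y z t : G) (I J : set G).

Let hU : unperforated G. Proof. by case: (acdg_dim hG). Qed.
Let hI : interpolation G. Proof. by case: (acdg_dim hG). Qed.
Let u0 : 0 <= u. Proof. by case: (acdg_unit hG). Qed.

Let half v t : 0 <= v -> t *+ 2 <= v ->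
  exists s, [/\ 0 <= s, t <= s & s *+ 2 <= v].
Proof.
move=> v0 tv.
have tv1 : t <= v.
  apply: (unperforated_le hU (n := 2)) => //; apply: le_trans tv _.
  by rewrite mulr2n -[leLHS]addr0 poag_leD.
have tv2 : t <= v - t by rewrite poag_lerBrDr -mulr2n.
have v1 : 0 <= v - t by rewrite poag_subr_ge0.
have [s1 [s1_0 s1_t s1_v s1_vt]] := hI v0 v1 tv1 tv2.
have h1 : 0 <= v - s1 by rewrite poag_subr_ge0.
have h2 : t <= v - s1 by rewrite poag_lerBrDr addrC -poag_lerBrDr.
have [s [s_0 s_t s_s1 s_v]] := hI s1_0 h1 s1_t h2.
exists s; split=> //; rewrite mulr2n -poag_lerBrDr; apply: le_trans s_v _.
by rewrite poag_leD // poag_leN.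
Qed.

Let halves k v t : 0 <= v -> t *+ (2 ^ k) <= v ->
  exists s, [/\ 0 <= s, t <= s & s *+ (2 ^ k) <= v].
Proof.
elim: k v => [|k IH] v v0.
  by rewrite expn0 !mulr1n => tv; exists v.
rewrite expnSr mulrnA => /(half v0)[s1 [s10 ts1 s1v]].
have [s [s0 ts ss1]] := IH _ s10 ts1.
exists s; split=> //; rewrite mulrnA.
exact: le_trans (poag_leMn 2 ss1) s1v.
Qed.

Let riesz z x y : 0 <= z -> 0 <= x -> 0 <= y -> z <= x + y ->
  exists r s, [/\ z = r + s, 0 <= r <= x & 0 <= s <= y].
Proof.
move=> z0 x0 y0 zxy.
have h1 : z - y <= z by rewrite poag_lerBlDr -[leLHS]addr0 poag_leD.
have h2 : z - y <= x by rewrite poag_lerBlDr.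
have [r [r0 zr rz rx]] := hI z0 x0 h1 h2.
exists r, (z - r); split; first by rewrite addrC subrK.
  by rewrite r0.
by rewrite poag_subr_ge0 rz /= poag_lerBlDr addrC -poag_lerBlDr.
Qed.

Let close_below I z : interval I ->
  (forall e : R, 0 < e -> exists2 w, I w & order_norm R u (z - w) < e) ->
  forall k, exists w, [/\ I w, w <= z & (z - w) *+ (2 ^ k) <= u].
Proof.
move=> [_ _ Ilow] cl k.
have k0 : (0 < 2 ^ k)%N by rewrite expn_gt0.
have [|w Iw /(order_norm_lt hU (acdg_unit hG) k0)[_ wu]] := cl (2 ^ k)%:R^-1.
  by rewrite invr_gt0 ltr0n.
have [s [s0 ts su]] := halves u0 wu.
exists (z - s); split; last by rewrite opprB addrC subrK.
  by apply: Ilow Iw; rewrite poag_lerBlDr addrC -poag_lerBlDr.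
by rewrite poag_lerBlDr -[leLHS]addr0 poag_leD.
Qed.

Lemma norm_limit_unique t :
  (forall k, t *+ (2 ^ k) <= u) -> t <= 0.
Proof.
move=> h; apply: (acdg_arch hG (b := u)) => n.
have [t0 [tt0 [t00 tn]]] : exists s, t <= s /\ (0 <= s /\ s *+ (2 ^ n) <= u).
  by have [s [? ? ?]] := halves u0 (h n); exists s.
apply: le_trans (poag_leMn n tt0) _; apply: le_trans tn.
rewrite -(subnK (ltnW (ltn_expl n (isT : 1 < 2)%N))) mulrnDr -[leLHS]add0r.
by rewrite poag_leD // poag_ge0Mn.
Qed.

Lemma interval_zeroP : interval (@interval_zero G).
Proof.
split; first by exists 0; rewrite /interval_zero /=.
  by move=> x y x0 y0; exists 0; split => //; rewrite /interval_zero /=.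
by move=> x y xy y0; apply: le_trans xy y0.
Qed.

Lemma interval_zero_closed : norm_closed R u (@interval_zero G).
Proof.
move=> z /(close_below interval_zeroP) h; apply: norm_limit_unique => k.
have [w [w0 _ hw]] := h k; apply: le_trans hw; apply: poag_leMn.
by rewrite poag_lerBrDr -[leRHS]addr0 poag_leD.
Qed.

Lemma interval_addP I J : interval I -> interval J -> interval (interval_add I J).
Proof.
move=> [[x Ix] Idir Ilow] [[y Jy] Jdir Jlow]; split.
- by exists (x + y), x, y.
- move=> z1 z2 [x1 [y1 [Ix1 Jy1 h1]]] [x2 [y2 [Ix2 Jy2 h2]]].
  have [x' [Ix' x1x' x2x']] := Idir _ _ Ix1 Ix2.
  have [y' [Jy' y1y' y2y']] := Jdir _ _ Jy1 Jy2.
  exists (x' + y'); split; first by exists x', y'.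
    by apply: le_trans h1 _; exact: poag_leD.
  by apply: le_trans h2 _; exact: poag_leD.
- move=> z1 z2 z12 [x2 [y2 [Ix2 Jy2 h2]]]; exists x2, y2; split=> //.
  exact: le_trans z12 h2.
Qed.

Let step I J z k x y :
  interval I -> interval J ->
  (forall k, exists w, [/\ interval_add I J w, w <= z & (z - w) *+ (2 ^ k) <= u]) ->
  I x -> J y -> x + y <= z ->
  exists p : G * G, [/\ I p.1, J p.2,
    p.1 + p.2 <= z, (z - (p.1 + p.2)) *+ (2 ^ k) <= u
    & [/\ x <= p.1, y <= p.2, p.1 - x <= z - (x + y) & p.2 - y <= z - (x + y)]].
Proof.
move=> [_ Idir Ilow] [_ Jdir Jlow] h Ix Jy xyz.
have [w [[p0 [q0 [Ip0 Jq0 wpq0]]] wz hw]] := h k.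
have [p [Ip xp p0p]] := Idir _ _ Ix Ip0.
have [q [Jq yq q0q]] := Jdir _ _ Jy Jq0.
have wpq : w <= p + q by apply: le_trans wpq0 _; exact: poag_leD.
have [v [xyv wv vz vpq]] := hI xyz (poag_leD xp yq) wz wpq.
have [||||r [s [rs /andP[r0 rp] /andP[s0 sq]]]] := @riesz (v - (x + y)) (p - x) (q - y).
- by rewrite poag_subr_ge0.
- by rewrite poag_subr_ge0.
- by rewrite poag_subr_ge0.
- by rewrite addrACA -opprD poag_leD.
have E : (x + r) + (y + s) = v by rewrite addrACA -rs addrC subrK.
have vz' : v - (x + y) <= z - (x + y) by rewrite poag_leD.
exists (x + r, y + s); rewrite /= E; split => //.
- by apply: Ilow Ip; rewrite addrC -poag_lerBrDr.
- by apply: Jlow Jq; rewrite addrC -poag_lerBrDr.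
- by apply: le_trans hw; apply: poag_leMn; rewrite poag_leD // poag_leN.
- rewrite [x + r - x]addrAC subrr add0r [y + s - y]addrAC subrr add0r.
  split.
  + by rewrite -[leLHS]addr0 poag_leD.
  + by rewrite -[leLHS]addr0 poag_leD.
  + by apply: le_trans vz'; rewrite rs -[leLHS]addr0 poag_leD.
  + by apply: le_trans vz'; rewrite rs -[leLHS]add0r poag_leD.
Qed.

Let seq_cvg I (f : nat -> G) : norm_closed R u I ->
  (forall n, I (f n)) -> (forall n, f n <= f n.+1) ->
  (forall n m, (n <= m)%N -> (f m - f n) *+ (2 ^ n) <= u) ->
  exists l, I l /\ forall k, exists N, forall n, (N <= n)%N ->
     (f n - l) *+ (2 ^ k) <= u.
Proof.
move=> Icl If fS fu.
have fle n m : (n <= m)%N -> f n <= f m.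
  move/subnK <-; elim: (m - n)%N => [|d IH]; first by rewrite add0n.
  by rewrite addSn; apply: le_trans IH _.
have fsm N m n : (N <= m)%N -> (N <= n)%N ->
    - u <= (f m - f n) *+ (2 ^ N) /\ (f m - f n) *+ (2 ^ N) <= u.
  have key a b : (N <= a)%N -> (N <= b)%N -> (f a - f b) *+ (2 ^ N) <= u.
    move=> Na Nb; apply: le_trans (fu N a Na); apply: poag_leMn.
    by rewrite poag_leD // poag_leN fle.
  move=> Nm Nn; split; last exact: key.
  by rewrite -poag_leN opprK -mulNrn opprB; exact: key.
have p2 N : (0 < 2 ^ N)%N by rewrite expn_gt0.
have cf : norm_cauchy R u f.
  move=> e /small_pow2[N hN]; exists N => m n Nm Nn.
  have [h1 h2] := fsm N m n Nm Nn.
  by apply: le_lt_trans (order_norm_le R (p2 N) h1 h2) hN.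
have [l fl] := acdg_complete hG cf.
have flk k : exists N, forall n, (N <= n)%N ->
    - u <= (f n - l) *+ (2 ^ k) /\ (f n - l) *+ (2 ^ k) <= u.
  have [|N hN] := fl (2 ^ k)%:R^-1; first by rewrite invr_gt0 ltr0n.
  by exists N => n /hN; exact: (order_norm_lt hU (acdg_unit hG)).
exists l; split; last first.
  by move=> k; have [N hN] := flk k; exists N => n /hN[].
apply: Icl => e /small_pow2[k hk]; have [N /(_ N (leqnn N))[h1 h2]] := flk k.
exists (f N) => //; apply: le_lt_trans hk; apply: order_norm_le => //.
  by rewrite -opprB mulNrn poag_leN.
by rewrite -opprB mulNrn -poag_leN opprK.
Qed.

Lemma interval_add_closed I J : interval I -> interval J ->
  norm_closed R u I -> norm_closed R u J -> norm_closed R u (interval_add I J).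
Proof.
move=> hIi hJi Icl Jcl z /(close_below (interval_addP hIi hJi)) h.
pose T := {p : G * G | [/\ I p.1, J p.2 & p.1 + p.2 <= z]}.
have nxt (k : nat) (p : T) : {q : T | (z - ((sval q).1 + (sval q).2)) *+ (2 ^ k) <= u
    /\ [/\ (sval p).1 <= (sval q).1, (sval p).2 <= (sval q).2,
      (sval q).1 - (sval p).1 <= z - ((sval p).1 + (sval p).2)
    & (sval q).2 - (sval p).2 <= z - ((sval p).1 + (sval p).2)]}.
  apply: cid; case: p => -[x y] /= [Ix Jy xyz].
  have [q [q1 q2 q3 q4 q5]] := step k hIi hJi h Ix Jy xyz.
  have qT : [/\ I q.1, J q.2 & q.1 + q.2 <= z] by split.
  by exists (exist _ q qT : T).
have [p0 _] : exists p : T, True.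
  have [w [[x [y [Ix Jy wxy]]] wz _]] := h 0%N.
  have pT : [/\ I (x, w - x).1, J (x, w - x).2 & (x, w - x).1 + (x, w - x).2 <= z].
    rewrite /= [x + _]addrC subrK; split=> //; case: hJi => _ _ Jlow; apply: Jlow Jy.
    by rewrite poag_lerBlDr addrC.
  have t : T by exists (x, w - x).
  by exists t.
pose g := fix g n : T := if n is m.+1 then sval (nxt n (g m)) else sval (nxt 0%N p0).
pose f1 n := (sval (g n)).1; pose f2 n := (sval (g n)).2.
have gu n : (z - (f1 n + f2 n)) *+ (2 ^ n) <= u.
  by rewrite /f1 /f2; case: n => [|n] /=; case: (nxt _ _) => q /= [].
have gT n : [/\ I (f1 n), J (f2 n) & f1 n + f2 n <= z] by exact: (svalP (g n)).
have gS n : f1 n <= f1 n.+1 /\ f2 n <= f2 n.+1.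
  by rewrite /f1 /f2 /=; case: (nxt _ _) => q /= [_ []].
have f1le n m : (n <= m)%N -> f1 n <= f1 m.
  move/subnK <-; elim: (m - n)%N => [|d IH]; first by rewrite add0n.
  by rewrite addSn; apply: le_trans IH _; case: (gS (d + n)%N).
have f2le n m : (n <= m)%N -> f2 n <= f2 m.
  move/subnK <-; elim: (m - n)%N => [|d IH]; first by rewrite add0n.
  by rewrite addSn; apply: le_trans IH _; case: (gS (d + n)%N).
have b1 n m : (n <= m)%N -> (f1 m - f1 n) *+ (2 ^ n) <= u.
  move=> nm; apply: le_trans (gu n); apply: poag_leMn.
  rewrite poag_lerBrDr addrA subrK; case: (gT m) => _ _; apply: le_trans.
  by rewrite poag_leD // f2le.
have b2 n m : (n <= m)%N -> (f2 m - f2 n) *+ (2 ^ n) <= u.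
  move=> nm; apply: le_trans (gu n); apply: poag_leMn.
  rewrite poag_lerBrDr [f1 n + _]addrC addrA subrK addrC.
  by case: (gT m) => _ _; apply: le_trans; rewrite poag_leD // f1le.
have i1 n : I (f1 n) by case: (gT n).
have i2 n : J (f2 n) by case: (gT n).
have [x [Ix hx]] := seq_cvg Icl i1 (fun n => (gS n).1) b1.
have [y [Jy hy]] := seq_cvg Jcl i2 (fun n => (gS n).2) b2.
exists x, y; split=> //; rewrite -poag_subr_ge0 -poag_leN oppr0 opprB.
apply: norm_limit_unique => k.
have [N hN] := hx k.+2; have [M hM] := hy k.+2.
pose n := maxn k.+2 (maxn N M).
have nN : (N <= n)%N by rewrite /n !leq_max leqnn orbT.
have nM : (M <= n)%N by rewrite /n !leq_max leqnn !orbT.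
have nk : (k.+2 <= n)%N by rewrite /n leq_max leqnn.
have hz : (z - (f1 n + f2 n)) *+ (2 ^ k.+2) <= u.
  apply: le_trans (gu n).
  have -> : (2 ^ n = 2 ^ k.+2 * 2 ^ (n - k.+2))%N by rewrite -expnD subnKC.
  rewrite (mulrnA _ (2 ^ k.+2)); set t := _ *+ (2 ^ k.+2).
  have t0 : 0 <= t by apply: poag_ge0Mn; rewrite poag_subr_ge0; case: (gT n).
  have : (0 < 2 ^ (n - k.+2))%N by rewrite expn_gt0.
  case: (2 ^ _)%N => // j _; rewrite mulrS -[leLHS]addr0 poag_leD //.
  exact: poag_ge0Mn.
have E : z - (x + y) = (z - (f1 n + f2 n)) + ((f1 n - x) + (f2 n - y)).
  by rewrite [X in _ = _ + X]addrACA -opprD addrA subrK.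
apply: (unperforated_le hU (n := 4)) => //.
rewrite -mulrnA -(expnD 2 k 2) addn2 E mulrnDl [X in _ + X <= _]mulrnDl.
apply: (@le_trans _ _ (u + (u + u))).
  by rewrite poag_leD // poag_leD // ?hN ?hM.
by rewrite -mulr2n -mulrS [leRHS]mulrS -[leLHS]add0r poag_leD.
Qed.

End ClosedSum.

Section LambdaCl.
Variables (R : realType) (G : poagType) (u : G).

Definition closed_pos_interval : {pred set G} :=
  fun I => `[< [/\ interval I, I 0 & norm_closed R u I] >].

(* The proof [hG] is a parameter of the type because the sum of two
   norm-closed intervals is norm-closed only under such assumptions. *)
Definition Lambda_cl_pos of arch_complete_dimension_group R u :=
  {I : set G | I \in closed_pos_interval}.

Variable hG : arch_complete_dimension_group R u.
Local Notation L := (Lambda_cl_pos hG).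

HB.instance Definition _ := SubChoice.on L.

Let LP (I : L) : [/\ interval (val I), val I 0 & norm_closed R u (val I)].
Proof. exact/asboolP/(valP I). Qed.

Let zero_subproof : @interval_zero G \in closed_pos_interval.
Proof.
apply/asboolP; split; [exact: interval_zeroP| exact: lexx|].
exact: (interval_zero_closed hG).
Qed.

Let add_subproof (I J : L) : interval_add (val I) (val J) \in closed_pos_interval.
Proof.
have [i1 i2 i3] := LP I; have [j1 j2 j3] := LP J.
apply/asboolP; split; first exact: interval_addP.
  by exists 0, 0; rewrite addr0.
exact: (interval_add_closed hG).
Qed.

Definition Lambda_zero : L := Sub (@interval_zero G) zero_subproof.
Definition Lambda_add (I J : L) : L := Sub (interval_add (val I) (val J)) (add_subproof I J).

Let addA : associative Lambda_add.
Proof.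
move=> I J K; apply/val_inj/seteqP; split=> z /=.
  move=> [x [t [Ix [y [w [Jy Kw tyw]]] zxt]]].
  exists (x + y), w; split=> //; first by exists x, y.
  by rewrite -addrA; apply: le_trans zxt _; exact: poag_leD.
move=> [t [w [[x [y [Ix Jy txy]]] Kw ztw]]].
exists x, (y + w); split=> //; first by exists y, w.
by rewrite addrA; apply: le_trans ztw _; exact: poag_leD.
Qed.

Let addC : commutative Lambda_add.
Proof.
move=> I J; apply/val_inj/seteqP; split=> z /= [x [y [Ix Jy h]]];
  by exists y, x; rewrite addrC.
Qed.

Let add0 : left_id Lambda_zero Lambda_add.
Proof.
move=> I; apply/val_inj/seteqP; split=> z /=.
  move=> [x [y [x0 Iy zxy]]]; have [[_ _ Ilow] _ _] := LP I.
  by apply: Ilow Iy; apply: le_trans zxy _; rewrite -[leRHS]add0r poag_leD.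
by move=> Iz; exists 0, z; rewrite add0r; split=> //; exact: lexx.
Qed.

HB.instance Definition _ := GRing.isNmodule.Build L addA addC add0.

Definition Lambda_le (I J : L) : Prop := val I `<=` val J.

Let le_refl I : Lambda_le I I. Proof. by []. Qed.

Let le_anti I J : Lambda_le I J -> Lambda_le J I -> I = J.
Proof. by move=> IJ JI; apply/val_inj/seteqP. Qed.

Let le_trans J I K : Lambda_le I J -> Lambda_le J K -> Lambda_le I K.
Proof. exact: subset_trans. Qed.

Let leD2r K I J : Lambda_le I J -> Lambda_le (I + K) (J + K).
Proof.
by move=> IJ z [x [y [Ix Ky h]]]; exists x, y; split=> //; exact: IJ.
Qed.

Let ge0 I : Lambda_le 0 I.
Proof. by move=> z z0; have [[_ _ Il] I0 _] := LP I; exact: Il I0. Qed.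

HB.instance Definition _ := isPosOrderedMonoid.Build L
  le_refl le_anti le_trans leD2r ge0.

End LambdaCl.

Section Restr.
Variable A : pomonType.

Definition alg_le (x y : A) : Prop := exists z, x + z = y.

Definition restr_pred (d : A) : {pred A} :=
  fun x => `[< exists2 n : nat, (0 < n)%N & alg_le x (d *+ n) >].

Variable d : A.

Let restr_closed : GRing.addr_closed (restr_pred d).
Proof.
split; first by apply/asboolP; exists 1%N => //; exists d; rewrite add0r.
move=> x y /asboolP[n n0 [z zE]] /asboolP[m m0 [t tE]].
apply/asboolP; exists (n + m)%N; first by rewrite addn_gt0 n0.
by exists (z + t); rewrite addrACA zE tE mulrnDr.
Qed.

Definition restr := {x : A | x \in restr_pred d}.

HB.instance Definition _ := SubChoice.on restr.
HB.instance Definition _ :=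
  GRing.SubChoice_isSubNmodule.Build A (restr_pred d) restr restr_closed.

Definition restr_le (x y : restr) : Prop := pomon_le (val x) (val y).

Let le_refl x : restr_le x x. Proof. exact: pomon_le_refl. Qed.

Let le_anti x y : restr_le x y -> restr_le y x -> x = y.
Proof. by move=> xy yx; apply/val_inj/pomon_le_anti. Qed.

Let le_trans y x z : restr_le x y -> restr_le y z -> restr_le x z.
Proof. exact: pomon_le_trans. Qed.

Let leD2r z x y : restr_le x y -> restr_le (x + z) (y + z).
Proof. by rewrite /restr_le !raddfD; exact: pomon_leD2r. Qed.

Let ge0 x : restr_le 0 x.
Proof. by rewrite /restr_le raddf0; exact: pomon_ge0. Qed.

HB.instance Definition _ := isPosOrderedMonoid.Build restr
  le_refl le_anti le_trans leD2r ge0.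

Let unit_subproof : d \in restr_pred d.
Proof. by apply/asboolP; exists 1%N => //; exists 0; rewrite addr0. Qed.

Definition restr_unit : restr := Sub d unit_subproof.

End Restr.

Section Grot.
Variable B : nmodType.
Implicit Types p q r : B * B.

(* (x, y) stands for [x] - [y] *)
Definition grot_rel p q : bool :=
  `[< exists c, p.1 + q.2 + c = q.1 + p.2 + c >].

Let grot_refl : reflexive grot_rel.
Proof. by move=> p; apply/asboolP; exists 0. Qed.

Let grot_sym : symmetric grot_rel.
Proof.
by move=> p q; apply/asboolP/asboolP => -[c cE]; exists c; rewrite cE.
Qed.

Let grot_trans : transitive grot_rel.
Proof.
move=> [x x'] [y y'] [z z'] /asboolP[c /= xy] /asboolP[d /= yz].
apply/asboolP; exists (x + x' + c + d) => /=.
transitivity ((y + x' + c) + (x + z' + d)).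
  by rewrite !addrA [LHS](ACl (1*4*5*3*2*6)).
by rewrite xy yz !addrA [LHS](ACl (4*2*1*5*3*6)).
Qed.

Canonical grot_equiv := EquivRel grot_rel grot_refl grot_sym grot_trans.

Definition Grot := {eq_quot grot_equiv}.

HB.instance Definition _ := Choice.on Grot.
HB.instance Definition _ := EqQuotient.on Grot.

Let grotP p q : reflect (\pi_Grot p = \pi_Grot q) (grot_rel p q).
Proof. exact: eqmodP. Qed.

Definition grot_class (x : B) : Grot := \pi_Grot (x, 0).
Definition grot_zero : Grot := \pi_Grot (0, 0).
Definition grot_opp (a : Grot) : Grot := \pi_Grot ((repr a).2, (repr a).1).
Definition grot_add (a b : Grot) : Grot := \pi_Grot
  ((repr a).1 + (repr b).1, (repr a).2 + (repr b).2).

Let reprP p : exists c, (repr (\pi_Grot p)).1 + p.2 + c =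
                        p.1 + (repr (\pi_Grot p)).2 + c.
Proof. by apply/asboolP/grotP; rewrite reprK. Qed.

Let pi_opp p : grot_opp (\pi_Grot p) = \pi_Grot (p.2, p.1).
Proof.
have [c cE] := reprP p; apply/grotP/asboolP; exists c => /=.
rewrite [_ + p.1]addrC [p.2 + _]addrC; exact: esym cE.
Qed.

Let pi_add p q :
  grot_add (\pi_Grot p) (\pi_Grot q) = \pi_Grot (p.1 + q.1, p.2 + q.2).
Proof.
have [c cE] := reprP p; have [d dE] := reprP q.
apply/grotP/asboolP; exists (c + d) => /=.
by rewrite [X in X + (c + d) = _]addrACA [X in _ = X + (c + d)]addrACA [LHS]addrACA [RHS]addrACA cE dE.
Qed.

Let addA : associative grot_add.
Proof.
elim/quotW=> p; elim/quotW=> q; elim/quotW=> r.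
by rewrite (pi_add q r) (pi_add p q) !pi_add /= !addrA.
Qed.

Let addC : commutative grot_add.
Proof.
elim/quotW=> p; elim/quotW=> q; rewrite !pi_add.
by rewrite [p.1 + _]addrC [p.2 + _]addrC.
Qed.

Let add0 : left_id grot_zero grot_add.
Proof. by elim/quotW=> -[x y]; rewrite pi_add /= !add0r. Qed.

Let addN : left_inverse grot_zero grot_opp grot_add.
Proof.
elim/quotW=> -[x y]; rewrite pi_opp pi_add; apply/grotP/asboolP.
by exists 0; rewrite /= !addr0 add0r addrC.
Qed.

HB.instance Definition _ := GRing.isZmodule.Build Grot addA addC add0 addN.

Lemma grot_classD x y : grot_class (x + y) = grot_class x + grot_class y.
Proof. by rewrite {2 3}/grot_class [RHS]pi_add /= addr0. Qed.

Lemma grot_class0 : grot_class 0 = 0.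
Proof. by []. Qed.

Lemma grot_classB a : exists x y, a = grot_class x - grot_class y.
Proof.
elim/quotW: a => -[x y]; exists x, y.
by rewrite [- _]pi_opp [RHS]pi_add /= addr0 add0r.
Qed.

Lemma grot_class_eq x y :
  grot_class x = grot_class y <-> exists c, x + c = y + c.
Proof.
split=> [/grotP/asboolP[c]|[c cE]]; first by rewrite /= !addr0; exists c.
by apply/grotP/asboolP; exists c; rewrite /= !addr0.
Qed.

End Grot.

Section GrotOrder.
Variable B : pomonType.

Definition grot_le (a b : Grot B) : bool :=
  `[< exists x, b - a = grot_class x >].

Let le_refl : reflexive grot_le.
Proof. by move=> a; apply/asboolP; exists 0; rewrite subrr. Qed.

Let le_trans : transitive grot_le.
Proof.
move=> b a c /asboolP[x xE] /asboolP[y yE]; apply/asboolP; exists (y + x).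
by rewrite grot_classD -xE -yE addrA subrK.
Qed.

Let le_anti : antisymmetric grot_le.
Proof.
move=> a b /andP[/asboolP[x xE] /asboolP[y yE]].
have : grot_class (x + y) = grot_class 0.
  by rewrite grot_classD -xE -yE addrA subrK subrr.
move=> /grot_class_eq[c cE]; have x0 : grot_class x = grot_class 0.
  apply/grot_class_eq; exists c; apply: pomon_le_anti; last first.
    by apply: pomon_leD2r; exact: pomon_ge0.
  rewrite -cE -addrA [y + c]addrC addrA -[X in pomon_le X _]add0r addrC.
  by rewrite [X in pomon_le _ X]addrC; apply: pomon_leD2r; exact: pomon_ge0.
by apply/esym/eqP; rewrite -subr_eq0 xE x0.
Qed.

HB.instance Definition _ :=
  Order.Le_isPOrder.Build ring_display (Grot B) le_refl le_anti le_trans.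

Let leD2r (c a b : Grot B) : a <= b -> a + c <= b + c.
Proof.
move=> /asboolP[x xE]; apply/asboolP; exists x.
by rewrite opprD addrACA subrr addr0.
Qed.

HB.instance Definition _ := POrderedZmodule_isTransInv.Build (Grot B) leD2r.

Lemma grot_ge0 (a : Grot B) : 0 <= a <-> exists x, a = grot_class x.
Proof.
by split=> [/asboolP[x]|[x ->]]; rewrite ?subr0; [exists x|
  apply/asboolP; exists x; rewrite subr0].
Qed.

End GrotOrder.

Section GrotRestr.
Variables (A : pomonType) (d : A).

Definition Grot_unit : Grot (restr d) := grot_class (restr_unit d).

Lemma Grot_unitP : order_unit Grot_unit.
Proof.
have classMn n (x : restr d) : grot_class (x *+ n) = grot_class x *+ n.
  by elim: n => [|n IH]; rewrite ?mulr0n ?grot_class0// !mulrS grot_classD IH.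
split; first by apply/grot_ge0; exists (restr_unit d).
move=> a; have [x [y ->]] := grot_classB a.
have /asboolP[n n0 [z zE]] := valP x; exists n => //.
have zd : z \in restr_pred d.
  by apply/asboolP; exists n => //; exists (val x); rewrite addrC.
apply/asboolP; exists (Sub z zd + y).
suff -> : Grot_unit *+ n = grot_class x + grot_class (Sub z zd : restr d).
  by rewrite opprB [grot_class x + _]addrC [grot_class y - _]addrC addrA addrK grot_classD.
rewrite -grot_classD -classMn; congr grot_class; apply: val_inj.
by rewrite raddfMn raddfD /= zE.
Qed.

End GrotRestr.

Definition cancellative (B : nmodType) : Prop :=
  forall x y z : B, x + z = y + z -> x = y.

Section Mcl.
Variables (R : realType) (G : poagType) (u : G).
Variable (hG : arch_complete_dimension_group R u).
Variable d : Lambda_cl_pos hG.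

Definition M0_cl : pomonType := restr d.
Definition M_cl : poagType := Grot M0_cl.
Definition M_cl_unit : M_cl := Grot_unit d.

End Mcl.

(* Main.v *)
From mathcomp Require Import all_boot all_order all_algebra.
From mathcomp Require Import boolp classical_sets reals.
Require Import Defs.

(** Think of a bounded closed positive interval as a lower semicontinuous
affine function on the state space, the supremum of its elements. Then [M_cl d]
consists of differences of such functions, and the theorem says that the
differences obtained in this way are stable under uniform limits. The
proof works with the intervals themselves, equipped with the Hausdorff-type
uniformity [near], where [near k I J] says that every element of [I] exceeds an
element of [J] by at most the [2 ^ k]-th part of the unit.

Three facts about this uniformity carry the proof.
- Cancellation ([near_cancel]): if [I + X] is nearly contained in [J + X] and
  [X] is bounded, then [I] is nearly contained in [J]. From [a] in [I] one gets
  a chain of inequalities [a + x_i <= b_i + x_(i+1)] up to a small error;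
  summing [n] of them bounds [n] times [a - b] by a constant plus [n] small
  errors, and dividing by [n] gives the claim. With arbitrarily small errors
  this is the cancellation law.
- Completeness ([set_lim_interval], [set_lim_cvg]): a Cauchy sequence of positive
  intervals converges to a closed interval. The delicate point is that the limit
  is directed: an upper bound of two of its elements is the limit of a Cauchy
  sequence in [G] whose terms are produced by interpolation.
- Closedness of the algebraic order ([Lambda_cvg_alg_le]): if [q n <=+ p n],
  [p n] tends to [I] and [q n] tends to [J], then [J <=+ I]. The complements of
  [q n] in [p n] form a Cauchy sequence by approximate cancellation, so they
  converge by completeness.

Elements of [G] cannot be divided by [2 ^ k], but intervals have a substitute:
[Lambda_div k I], the interval of all [g] with [2 ^ k g] in [I], a rounded-down
quotient. It satisfies [Lambda_div_eq]: an equation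
[2 ^ k I + K = 2 ^ k J + K'] implies [I + K / 2 ^ k = J + K' / 2 ^ k].

Archimedean property: if [n a <= b] for all [n], with [a = [x] - [y]] and
[b = [z] - [w]], the case [n = 2 ^ k] divided by [2 ^ k] gives
[x <=+ y + z / 2 ^ k]. As [z / 2 ^ k] tends to [0], closedness gives [x <=+ y].

Norm-completeness: along a fast subsequence [[x k] - [y k]] of a Cauchy
sequence, consecutive differences multiplied by [2 ^ k] lie between [- [d]] and
[[d]]; dividing, such a difference is [p k - q k] with [q k = d / 2 ^ k] and
[p k = v k / 2 ^ k], [v k <=+ 2 d]. The series of the [p k] and of the [q k]
converge, to [Pl] and [Ql] say. In general [p k] and [q k] do not lie below a
multiple of [d] for [<=+], so [Pl] and [Ql] need not have classes in [M_cl d];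
but closedness gives [Ql <=+ Pl + d] and [Pl <=+ Ql + d], and the two complements
[F] and [F'] add up to [2 d]. Hence [F] is below [2 d], and
[[x 0] - [y 0] + [F] - [d]] is an element of [M_cl d]; it is the limit, again by
closedness. *)

Set Implicit Arguments.
Unset Strict Implicit.
Unset Printing Implicit Defensive.

Import Order.TTheory GRing.Theory Num.Theory.

Local Open Scope ring_scope.
Local Open Scope classical_set_scope.

(** * Ordered groups with interpolation *)

(** If [m * x >= 0], the multiples of [- x] are bounded above: writing
[n = q * m + r], only the remaining [r < m] copies of [- x] contribute. *)
Lemma archimedean_unperforated (G : poagType) (u : G) :
  order_unit u -> archimedean G -> unperforated G.
Proof.
move=> [u0 hu] arch m x m0 xm; rewrite -poag_leN oppr0.
have [N _ xN] := hu (- x).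
apply: (arch _ (u *+ (N * m))) => n.
rewrite (divn_eq n m) mulrnDr -[leRHS]add0r; apply: poag_leD.
  by rewrite mulnC mulrnA mulNrn -mulNrn -[leRHS](mul0rn _ (n %/ m));
    apply: poag_leMn; rewrite mulNrn -poag_leN opprK oppr0.
apply: le_trans (poag_leMn _ xN) _; rewrite -mulrnA.
rewrite -(subnK (leq_mul (leqnn N) (ltnW (ltn_pmod n m0)))) mulrnDr.
by rewrite -[leLHS]add0r; apply: poag_leD => //; exact: poag_ge0Mn.
Qed.

Section Interpolation.
Variable G : poagType.
Hypotheses (hU : unperforated G) (hI : interpolation G).
Implicit Types x y v s : G.

Lemma interpolation3 a0 a1 a2 b0 b1 : a0 <= b0 -> a0 <= b1 ->
  a1 <= b0 -> a1 <= b1 -> a2 <= b0 -> a2 <= b1 ->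
  exists c : G, [/\ a0 <= c, a1 <= c, a2 <= c, c <= b0 & c <= b1].
Proof.
move=> h00 h01 h10 h11 h20 h21.
have [c [h0c h1c hc0 hc1]] := hI h00 h01 h10 h11.
have [e [hce h2e he0 he1]] := hI hc0 hc1 h20 h21.
by exists e; split=> //; [exact: le_trans h0c hce | exact: le_trans h1c hce].
Qed.

(** As [x + y <= v], interpolation between [x, y] and [v - x, v - y] gives [c];
then [x, y] lie below both [c] and [v - c], and twice a common interpolant is
at most [c + (v - c)]. *)
Let halve x y v : x *+ 2 <= v -> y *+ 2 <= v ->
  exists s, [/\ x <= s, y <= s & s *+ 2 <= v].
Proof.
move=> xv yv.
have xyv : x + y <= v.
  by apply: (unperforated_le hU (n := 2)) => //; rewrite mulrnDl mulr2n poag_leD.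
have [c [xc yc cx cy]] : exists c, [/\ x <= c, y <= c, c <= v - x & c <= v - y].
  by apply: hI; rewrite poag_lerBrDr -?mulr2n // addrC.
have [s [xs ys sc scv]] : exists s, [/\ x <= s, y <= s, s <= c & s <= v - c].
  by apply: hI; rewrite // poag_lerBrDr addrC -poag_lerBrDr.
exists s; split=> //; rewrite mulr2n; apply: le_trans (poag_leD sc scv) _.
by rewrite addrC subrK.
Qed.

(** A substitute for the interpolant [v / 2 ^ k] when [v] is not divisible. The
factor is a power of [2] so that the proof can halve repeatedly. *)
Lemma interpolate_div k x y v : x *+ 2 ^ k <= v -> y *+ 2 ^ k <= v ->
  exists s, [/\ x <= s, y <= s & s *+ 2 ^ k <= v].
Proof.
elim: k v => [|k IH] v; first by rewrite !mulr1n => xv yv; exists v.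
rewrite expnSr !mulrnA => xv yv.
have [w [xw yw wv]] := halve xv yv.
have [s [xs ys sw]] := IH _ xw yw.
by exists s; split=> //; rewrite mulrnA; exact: le_trans (poag_leMn 2 sw) wv.
Qed.

End Interpolation.

(** * The uniformity given by the order-unit norm *)

Section Near.
Variables (R : realType) (G : poagType) (u : G).
Hypothesis hG : arch_complete_dimension_group R u.
Implicit Types (x y z s : G) (I J K X : set G).

Let hU : unperforated G. Proof. by case: (acdg_dim hG). Qed.
Let hI : interpolation G. Proof. by case: (acdg_dim hG). Qed.
Let u0 : 0 <= u. Proof. by case: (acdg_unit hG). Qed.

(** The bound is one-sided, so that it is inherited by smaller elements;
[small_ub] gives back a nonnegative element with the same bound. *)
Definition small (k : nat) x := x *+ 2 ^ k <= u.

Lemma small_le k x y : x <= y -> small k y -> small k x.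
Proof. by move=> xy; apply: le_trans; exact: poag_leMn. Qed.

Lemma small0 k : small k 0.
Proof. by rewrite /small mul0rn. Qed.

(** The half-epsilon argument: the order [k.+1] plays the part of one half of the
order [k], and unperforation removes the factor [2] left at the end. *)
Lemma smallD k x y : small k.+1 x -> small k.+1 y -> small k (x + y).
Proof.
rewrite /small !expnSr !mulrnA => hx hy; apply: (unperforated_le hU (n := 2)) => //.
by rewrite !mulrnDl [leRHS]mulr2n poag_leD.
Qed.

Lemma smallS k x : small k.+1 x -> small k x.
Proof. by move=> hx; rewrite -[x]addr0; apply: smallD => //; exact: small0. Qed.

Lemma small_leq j k x : (j <= k)%N -> small k x -> small j x.
Proof.
by move/subnK <-; elim: (k - j)%N => // d IH; rewrite addSn => /smallS.
Qed.

Lemma small_archimedean x : (forall k, small k x) -> x <= 0.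
Proof. exact: (norm_limit_unique hG). Qed.

Lemma small_norm_lt k x :
  order_norm R u x < (2 ^ k)%:R^-1 -> small k x /\ small k (- x).
Proof.
move=> /(order_norm_lt hU (acdg_unit hG)); rewrite expn_gt0 => /(_ isT)[h1 h2].
by split=> //; rewrite /small mulNrn -poag_leN opprK.
Qed.

Lemma small_norm_le k x :
  small k x -> small k (- x) -> order_norm R u x <= (2 ^ k)%:R^-1.
Proof.
move=> h1; rewrite /small mulNrn -poag_leN opprK => h2.
by apply: order_norm_le => //; rewrite expn_gt0.
Qed.

Lemma bounded_small (b : G) :
  exists j, forall k x, x *+ 2 ^ (k + j) <= b -> small k x.
Proof.
have [n n0 bn] := (acdg_unit hG).2 b; exists n => k x.
rewrite expnD mulrnA => /le_trans/(_ bn) xb.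
apply: (unperforated_le hU (n := 2 ^ n)); first by rewrite expn_gt0.
apply: le_trans xb _.
rewrite -(subnK (ltnW (ltn_expl n (isT : 1 < 2)%N))) mulrnDr -[leLHS]add0r.
by rewrite poag_leD // poag_ge0Mn.
Qed.

Lemma small_ub k x y : small k x -> small k y ->
  exists s, [/\ 0 <= s, x <= s, y <= s & small k s].
Proof.
move=> hx hy; have [s [xs ys hs]] := interpolate_div hU hI hx hy.
have [s' [ss' s'0 hs']] := interpolate_div hU hI hs (small0 k).
by exists s'; split=> //; [exact: le_trans xs ss' | exact: le_trans ys ss'].
Qed.

(** For a lower set [J], the element [h] can be taken below [g], by [small_ub], so
this is a one-sided Hausdorff distance for the order-unit norm. *)
Definition near k I J := forall g, I g -> exists2 h, J h & small k (g - h).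

Lemma sub_near k I J : I `<=` J -> near k I J.
Proof. by move=> IJ g Ig; exists g; [exact: IJ | rewrite subrr; exact: small0]. Qed.

Lemma near_trans k J I K : near k.+1 I J -> near k.+1 J K -> near k I K.
Proof.
move=> IJ JK g /IJ[h /JK[l Kl hl] gh]; exists l => //.
by rewrite -(subrK h g) -addrA; exact: smallD.
Qed.

Lemma near_add k I I' J J' : near k.+1 I I' -> near k.+1 J J' ->
  near k (interval_add I J) (interval_add I' J').
Proof.
move=> II' JJ' z [x [y [/II'[x' I'x' hx] /JJ'[y' J'y' hy] zxy]]].
exists (x' + y'); first by exists x', y'.
apply: small_le (smallD hx hy).
by rewrite addrACA -opprD poag_leD.
Qed.

Lemma norm_closed_near J : interval J -> norm_closed R u J ->
  forall z, (forall k, exists2 h, J h & small k (z - h)) -> J z.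
Proof.
move=> [_ _ Jlow] cl z hz; apply: cl => e /small_pow2[k hk].
have [h Jh zh] := hz k; have [s [s0 zs _ hs]] := small_ub zh zh.
exists (z - s); first by apply: Jlow Jh; rewrite poag_lerBlDr addrC -poag_lerBlDr.
apply: le_lt_trans hk; rewrite opprB addrC subrK; apply: small_norm_le => //.
by apply: small_le (small0 k); rewrite -poag_leN opprK oppr0.
Qed.

Lemma near_norm_closed J :
  (forall z, (forall k, exists2 h, J h & small k (z - h)) -> J z) ->
  norm_closed R u J.
Proof.
move=> cl z hz; apply: cl => k.
have [|w Jw /small_norm_lt[zw _]] := hz (2 ^ k)%:R^-1; last by exists w.
by rewrite invr_gt0 ltr0n expn_gt0.
Qed.

Lemma near_sub I J : interval J -> norm_closed R u J ->
  (forall k, near k I J) -> I `<=` J.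
Proof.
by move=> hJ cl IJ z Iz; apply: (norm_closed_near hJ cl) => k; exact: IJ.
Qed.

(** Chaining the hypothesis [n] times from [a + x0] gives
[n a + x0 <= n b + x + n e] with [b] in [J], [x] in [X] and [e] the error of one
step; since [x - x0] is bounded independently of [n], its contribution to
[a - b] is negligible for large [n]. *)
Lemma near_cancel k I J X : interval J -> X !=set0 -> interval_bounded X ->
  near k.+1 (interval_add I X) (interval_add J X) -> near k I J.
Proof.
move=> [[b0 Jb0] Jdir _] [x0 Xx0] [B XB] hnear a Ia.
have chain n : exists b x,
    [/\ J b, X x & (a *+ n + x0) *+ 2 ^ k.+1 <= (b *+ n + x) *+ 2 ^ k.+1 + u *+ n].
  elim: n => [|n [b [x [Jb Xx hn]]]]; first by exists b0, x0; rewrite addr0.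
  have [|w [b' [x' [Jb' Xx' wbx]]] hw] := hnear (a + x).
    by exists a, x; split.
  have [b'' [Jb'' bb'' b'b'']] := Jdir _ _ Jb Jb'.
  exists b'', x'; split=> //.
  have h1 : (a + x) *+ 2 ^ k.+1 <= (b'' + x') *+ 2 ^ k.+1 + u.
    rewrite [leRHS]addrC -poag_lerBlDr -mulrnBl; apply: le_trans hw; apply: poag_leMn.
    rewrite poag_leD // poag_leN; apply: le_trans wbx _; exact: poag_leD.
  have h2 : (a *+ n + x0) *+ 2 ^ k.+1 <= (b'' *+ n + x) *+ 2 ^ k.+1 + u *+ n.
    apply: le_trans hn _; rewrite poag_leD //; apply: poag_leMn.
    by rewrite poag_leD // poag_leMn.
  have := poag_leD h1 h2.
  have E1 : a + x + (a *+ n + x0) = a *+ n.+1 + x0 + x.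
    by rewrite mulrS addrACA [x + x0]addrC addrA.
  have E2 : b'' + x' + (b'' *+ n + x) = b'' *+ n.+1 + x' + x.
    by rewrite mulrS addrACA addrA.
  rewrite -mulrnDl E1 addrACA -mulrnDl E2 -mulrS !(mulrnDl _ _ x).
  rewrite [X in _ <= X]addrAC => /(poag_leD2r (- (x *+ 2 ^ k.+1))).
  by rewrite !addrK.
have [l l0 Bl] := (acdg_unit hG).2 (B - x0).
(* for [n = M * l], both the bounded part and the errors are at most [u *+ n] *)
pose M := (2 ^ k.+1)%N.
have M0 : (0 < M)%N by rewrite expn_gt0.
have [b [x [Jb Xx hb]]] := chain (M * l)%N; exists b => //.
apply: (unperforated_le hU (n := 2)) => //.
rewrite -mulrnA -expnSr -/M.
apply: (unperforated_le hU (n := M * l)); first by rewrite muln_gt0 M0.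
have h1 : (a - b) *+ M *+ (M * l) <= (x - x0) *+ M + u *+ (M * l).
  rewrite mulrnAC mulrnBl -(poag_subr_ge0 (_ *+ M)).
  have -> : (x - x0) *+ M + u *+ (M * l) - (a *+ (M * l) - b *+ (M * l)) *+ M =
            (b *+ (M * l) + x) *+ M + u *+ (M * l) - (a *+ (M * l) + x0) *+ M.
    rewrite addrAC [RHS]addrAC -!mulrnBl; congr (_ *+ M + _).
    by rewrite mulrnBl opprB [LHS]addrC opprD [RHS]addrACA.
  by rewrite poag_subr_ge0.
apply: le_trans h1 _; rewrite [leRHS]mulrnAC [leRHS]mulr2n poag_leD //.
rewrite mulnC mulrnA; apply: poag_leMn; apply: le_trans Bl.
by rewrite poag_leD // XB.
Qed.

End Near.

(** * Limits of sequences of intervals *)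

(** The moduli chosen for the various [k] are made monotone by summing them. *)
Lemma monotone_modulus (Q : nat -> nat -> nat -> Prop) :
  (forall k, exists N, forall m n, (N <= m)%N -> (N <= n)%N -> Q k m n) ->
  exists phi : nat -> nat, {homo phi : j k / (j <= k)%N} /\
    forall k m n, (phi k <= m)%N -> (phi k <= n)%N -> Q k m n.
Proof.
move=> /choice[psi hpsi]; exists (fun k => \sum_(i < k.+1) psi i)%N; split.
  move=> j k jk; rewrite -!(big_mkord xpredT psi).
  by rewrite [leqRHS](@big_cat_nat _ _ _ j.+1) //= leq_addr.
have le k : (psi k <= \sum_(i < k.+1) psi i)%N by rewrite big_ord_recr leq_addl.
move=> k m n km kn.
by apply: hpsi; [exact: leq_trans (le k) km | exact: leq_trans (le k) kn].
Qed.

Section Completeness.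
Variables (R : realType) (G : poagType) (u : G).
Hypothesis hG : arch_complete_dimension_group R u.
Implicit Types (x y z s e : G) (I J K X : set G) (p : nat -> set G).

Let hU : unperforated G. Proof. by case: (acdg_dim hG). Qed.
Let hI : interpolation G. Proof. by case: (acdg_dim hG). Qed.

Local Notation small := (small u).
Local Notation near := (near u).

(** The remainders telescope as a geometric series, summed from the far end so
that one step loses one order of smallness. *)
Lemma small_telescope k (f : nat -> G) :
  (forall j, small (k + j).+2 (f j.+1 - f j)) ->
  forall i j, small (k + j).+1 (f (i + j)%N - f j).
Proof.
move=> hf; elim=> [|i IH] j; first by rewrite subrr; exact: (small0 hG).
rewrite addSnnS -(subrK (f j.+1) (f _)) -addrA; apply: (smallD hG) (hf j).
by rewrite -addnS.
Qed.

Lemma small_series_cvg k (f : nat -> G) :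
  (forall j, small (k + j).+2 (f j.+1 - f j) /\ small (k + j).+2 (f j - f j.+1)) ->
  exists l, forall j, small (k + j) (f j - l) /\ small (k + j) (l - f j).
Proof.
move=> hf.
have up i j : small (k + j).+1 (f (i + j)%N - f j).
  by apply: small_telescope => {}j; have [] := hf j.
have dn i j : small (k + j).+1 (f j - f (i + j)%N).
  have -> : f j - f (i + j)%N = (- f (i + j)%N) - (- f j) by rewrite opprK addrC.
  apply: (@small_telescope _ (fun n => - f n)) => {}j.
  by rewrite opprK addrC; have [] := hf j.
have cauchy : norm_cauchy R u f.
  move=> e /small_pow2[N hN]; exists N => m n Nm Nn.
  have key a b : (N <= a)%N -> (N <= b)%N -> small N (f a - f b).
    move=> Na Nb; apply: (@small_leq _ _ _ hG N (k + N)); first exact: leq_addl.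
    rewrite -(subrK (f N) (f a)) -addrA; apply: (smallD hG).
      by rewrite -(subnK Na); exact: up.
    by rewrite -(subnK Nb); exact: dn.
  apply: le_lt_trans hN; apply: small_norm_le; first exact: key.
  by rewrite opprB; exact: key.
have [l fl] := acdg_complete hG cauchy; exists l => j.
have [|N /(_ (N + j)%N (leq_addr _ _))/(small_norm_lt hG)[h1 h2]] :=
  fl (2 ^ (k + j).+1)%:R^-1; first by rewrite invr_gt0 ltr0n expn_gt0.
split.
  by rewrite -(subrK (f (N + j)%N) (f j)) -addrA; exact: (smallD hG).
rewrite -(subrK (f (N + j)%N) l) -addrA; apply: (smallD hG) => //.
by rewrite -opprB.
Qed.

Definition set_cvg p I := forall k, exists N, forall n, (N <= n)%N ->
  near k (p n) I /\ near k I (p n).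

Definition set_cauchy p := forall k, exists N, forall m n,
  (N <= m)%N -> (N <= n)%N -> near k (p m) (p n).

(** The lower limit of the sequence: the elements whose distance to [p n] tends
to [0]. In the Cauchy case it is the limit. *)
Definition set_lim p : set G := [set z | forall k, exists N, forall n,
  (N <= n)%N -> exists2 h, p n h & small k (z - h)].

Lemma set_lim_closed p : norm_closed R u (set_lim p).
Proof.
apply: (near_norm_closed hG) => z hz k.
have [h /(_ k.+1)[N hN] zh] := hz k.+1; exists N => n /hN[g png hg].
by exists g => //; rewrite -(subrK h z) -addrA; exact: (smallD hG).
Qed.

Section Limit.
Variable p : nat -> set G.
Hypotheses (pint : forall n, interval (p n)) (p0 : forall n, p n 0)
  (pcauchy : set_cauchy p).

Let modulus : exists phi : nat -> nat, {homo phi : j k / (j <= k)%N} /\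
  forall k m n, (phi k <= m)%N -> (phi k <= n)%N -> near k (p m) (p n).
Proof. exact: monotone_modulus pcauchy. Qed.

(** One step of the construction of an upper bound of [z1] and [z2] in the limit.
The current approximation [e] in [p n] is moved to some [e'] in [p m] that
bounds [z1] and [z2] with half the error; interpolating between
[z1 - r, z2 - r, e - t] and [w, e + s] keeps [e'] close to [e] on both sides. *)
Let approx_step k m n e z1 z2 :
  p n e -> small k (z1 - e) -> small k (z2 - e) ->
  near k (p n) (p m) ->
  (exists2 h, p m h & small k.+1 (z1 - h)) ->
  (exists2 h, p m h & small k.+1 (z2 - h)) ->
  exists e', [/\ p m e', small k.+1 (z1 - e'), small k.+1 (z2 - e'),
    small k (e' - e) & small k (e - e')].
Proof.
move=> pe z1e z2e nm [w1 pw1 zw1] [w2 pw2 zw2].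
have [w3 pw3 ew3] := nm e pe; have [_ pdir plow] := pint m.
have [w12 [pw12 w112 w212]] := pdir _ _ pw1 pw2.
have [w [pw w12w w3w]] := pdir _ _ pw12 pw3.
have zw1' : small k.+1 (z1 - w).
  by apply: small_le zw1; rewrite poag_leD // poag_leN; exact: le_trans w112 w12w.
have zw2' : small k.+1 (z2 - w).
  by apply: small_le zw2; rewrite poag_leD // poag_leN; exact: le_trans w212 w12w.
have ew : small k (e - w) by apply: small_le ew3; rewrite poag_leD // poag_leN.
have [s [s0 z1s z2s hs]] := small_ub hG z1e z2e.
have [r [r0 z1r z2r hr]] := small_ub hG zw1' zw2'.
have [t [t0 et _ ht]] := small_ub hG ew ew.
have sub_le x (c : G) : 0 <= c -> x - c <= x.
  by move=> c0; rewrite poag_lerBlDr -[leLHS]addr0 poag_leD.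
have le_sub x y (c : G) : x - y <= c -> x - c <= y.
  by rewrite !poag_lerBlDr addrC.
have [||||||e' [h1 h2 h3 h4 h5]] :=
    @interpolation3 _ hI (z1 - r) (z2 - r) (e - t) w (e + s).
- exact: le_sub.
- by apply: le_trans (sub_le _ _ r0) _; rewrite addrC -poag_lerBlDr.
- exact: le_sub.
- by apply: le_trans (sub_le _ _ r0) _; rewrite addrC -poag_lerBlDr.
- exact: le_sub.
- by apply: le_trans (sub_le _ _ t0) _; rewrite -[leLHS]addr0 poag_leD.
exists e'; split.
- exact: plow pw.
- by apply: small_le hr; exact: le_sub.
- by apply: small_le hr; exact: le_sub.
- by apply: small_le hs; rewrite poag_lerBlDr addrC.
- by apply: small_le ht; exact: le_sub.
Qed.

(** Iterating [approx_step] from [e] gives a Cauchy sequence; the errors in the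
bounds for [z1] and [z2] tend to [0], so its limit is an exact upper bound. *)
Let approx_limit k n e z1 z2 : set_lim p z1 -> set_lim p z2 -> p n e ->
  (forall m, (n <= m)%N -> near k.+2 (p n) (p m)) ->
  small k.+2 (z1 - e) -> small k.+2 (z2 - e) ->
  exists l, [/\ set_lim p l, z1 <= l, z2 <= l & small k (e - l)].
Proof.
move=> lz1 lz2 pe pn z1e z2e.
have [phi [phi_le hphi]] := modulus.
have [N1 hN1] := choice lz1; have [N2 hN2] := choice lz2.
(* the first index is the given [n], so that the sequence can start at [e] *)
pose psi j := if j is i.+1 then
  maxn n (maxn (phi (k + j).+2) (maxn (N1 (k + j).+2) (N2 (k + j).+2))) else n.
have psi_near j : near (k + j).+2 (p (psi j)) (p (psi j.+1)).
  have phiS : (phi (k + j.+1).+2 <= psi j.+1)%N by rewrite !leq_max leqnn orbT.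
  case: j phiS => [|j] phiS; first by rewrite addn0; apply: pn; rewrite leq_max leqnn.
  apply: hphi; first by rewrite !leq_max leqnn orbT.
  by apply: leq_trans phiS; apply: phi_le; rewrite !ltnS leq_add2l.
pose T j e := [/\ p (psi j) e, small (k + j).+2 (z1 - e) & small (k + j).+2 (z2 - e)].
have step j (a : {e | T j e}) : {b : {e | T j.+1 e} |
    small (k + j).+2 (sval b - sval a) /\ small (k + j).+2 (sval a - sval b)}.
  apply/cid; case: a => a [pa z1a z2a] /=.
  have w1 : exists2 h, p (psi j.+1) h & small (k + j).+3 (z1 - h).
    by rewrite -addnS; apply: hN1; rewrite !leq_max leqnn !orbT.
  have w2 : exists2 h, p (psi j.+1) h & small (k + j).+3 (z2 - h).
    by rewrite -addnS; apply: hN2; rewrite !leq_max leqnn !orbT.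
  have [b [pb z1b z2b ba ab]] := approx_step pa z1a z2a (psi_near j) w1 w2.
  have Tb : T j.+1 b by split=> //; rewrite addnS.
  by exists (exist _ b Tb).
have Te : T 0%N e by split; rewrite ?addn0.
pose g := nat_rect (fun j => {e | T j e}) (exist _ e Te) (fun j a => sval (step j a)).
pose f j := sval (g j).
have fP j : T j (f j) by exact: (svalP (g j)).
have [|l hl] := @small_series_cvg k f.
  by move=> j; exact: (svalP (step j (g j))).
have zl z : (forall j, small (k + j).+2 (z - f j)) -> z <= l.
  move=> zf; rewrite -(subrK l z) -[leRHS]add0r; apply: poag_leD => //.
  apply: (small_archimedean hG) => i.
  rewrite -(subrK (f i.+1) z) -addrA; apply: (smallD hG).
    apply: (small_leq hG _ (zf i.+1)).
    exact: leq_trans (leq_addl k i.+1) (leq_trans (leqnSn _) (leqnSn _)).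
  exact: (small_leq hG (leq_addl k i.+1) (hl i.+1).1).
exists l; split.
- move=> i; exists (phi (k + i.+1).+2) => m hm.
  have hj : (phi (k + i.+1).+2 <= psi i.+1)%N by rewrite !leq_max leqnn orbT.
  have [h ph fh] : exists2 h, p m h & small (k + i.+1).+2 (f i.+1 - h).
    by have [pf _ _] := fP i.+1; exact: hphi hj hm _ pf.
  exists h => //; rewrite -(subrK (f i.+1) l) -addrA; apply: (smallD hG).
    exact: (small_leq hG (leq_addl k i.+1) (hl i.+1).2).
  apply: (small_leq hG _ fh).
  exact: leq_trans (leq_addl k i.+1) (leq_trans (leqnSn _) (leqnSn _)).
- by apply: zl => j; have [] := fP j.
- by apply: zl => j; have [] := fP j.
- by have [+ _] := hl 0%N; rewrite addn0.
Qed.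

Let set_lim_lower x y : x <= y -> set_lim p y -> set_lim p x.
Proof.
move=> xy ly k; have [N hN] := ly k; exists N => n /hN[h ph yh]; exists h => //.
by apply: small_le yh; rewrite poag_leD.
Qed.

Lemma set_lim0 : set_lim p 0.
Proof. by move=> k; exists 0%N => n _; exists 0; rewrite ?subrr //; exact: (small0 hG). Qed.

Lemma set_lim_interval : interval (set_lim p).
Proof.
split; [by exists 0; exact: set_lim0 | | exact: set_lim_lower].
move=> z1 z2 lz1 lz2; have [phi [_ hphi]] := modulus.
have [N1 hN1] := lz1 2%N; have [N2 hN2] := lz2 2%N.
pose n := maxn (phi 2%N) (maxn N1 N2).
have [|h1 ph1 zh1] := hN1 n; first by rewrite !leq_max leqnn orbT.
have [|h2 ph2 zh2] := hN2 n; first by rewrite !leq_max leqnn !orbT.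
have [_ pdir _] := pint n; have [e [pe h1e h2e]] := pdir _ _ ph1 ph2.
have z1e : small 2 (z1 - e) by apply: small_le zh1; rewrite poag_leD // poag_leN.
have z2e : small 2 (z2 - e) by apply: small_le zh2; rewrite poag_leD // poag_leN.
have [m nm|l [ll z1l z2l _]] := @approx_limit 0 n e z1 z2 lz1 lz2 pe _ z1e z2e.
  have hn : (phi 2 <= n)%N by rewrite leq_maxl.
  exact: hphi hn (leq_trans hn nm).
by exists l.
Qed.

(** An element [g] of [p n] is approximated within the limit by [approx_limit],
used with both lower bounds equal to one element of the limit below [g]. *)
Lemma set_lim_cvg : set_cvg p (set_lim p).
Proof.
move=> k; have [phi [_ hphi]] := modulus.
have near' N m n : (phi N <= m)%N -> (phi N <= n)%N -> near N (p m) (p n).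
  exact: hphi.
exists (maxn (phi k.+2) (phi k.+1)) => n; rewrite geq_max => /andP[n2 n1]; split.
  move=> g pg.
  (* a common lower bound of [0] and [g]: it lies in the limit and below [g] *)
  have [h h0 hg] : exists2 h, h <= 0 & h <= g.
    have [u0 /(_ (- g))[m _ gm]] := acdg_unit hG; exists (- (u *+ m)).
      by rewrite -poag_leN opprK oppr0 poag_ge0Mn.
    by rewrite -poag_leN opprK.
  have lh : set_lim p h by apply: set_lim_lower h0 set_lim0.
  have hs : small k.+2 (h - g).
    apply: small_le (small0 hG _).
    by rewrite poag_lerBlDr add0r.
  have [m nm|l [ll _ _ gl]] := approx_limit lh lh pg _ hs hs; last by exists l.
  by apply: near' => //; exact: leq_trans n2 nm.
move=> z lz; have [N hN] := lz k.+1.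
have [|h ph zh] := hN (maxn N (phi k.+1)); first exact: leq_maxl.
have [h' ph' hh'] := near' _ _ n (leq_maxr N (phi k.+1)) n1 _ ph.
by exists h' => //; rewrite -(subrK h z) -addrA; exact: (smallD hG).
Qed.

End Limit.
End Completeness.

(** * Convergence and division in the monoid of closed positive intervals *)

Section LambdaTheory.
Variables (R : realType) (G : poagType) (u : G).
Variable hG : arch_complete_dimension_group R u.
Local Notation L := (Lambda_cl_pos hG).
Local Notation small := (small u).
Local Notation near := (near u).
Local Notation bounded I := (interval_bounded (val I)).
Implicit Types (x y z g : G) (I J K : L) (p q : nat -> L).

Let hU : unperforated G. Proof. by case: (acdg_dim hG). Qed.
Let hI : interpolation G. Proof. by case: (acdg_dim hG). Qed.

Lemma LambdaP I : [/\ interval (val I), val I 0 & norm_closed R u (val I)].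
Proof. exact/asboolP/(valP I). Qed.

Lemma Lambda_subDr I J : val I `<=` val (I + J).
Proof.
by move=> x Ix; exists x, 0; rewrite addr0; split=> //; case: (LambdaP J).
Qed.

Lemma bounded_sub I J : val I `<=` val J -> bounded J -> bounded I.
Proof. by move=> IJ [b Jb]; exists b => x /IJ/Jb. Qed.

Lemma bounded_addl I J : bounded (I + J) -> bounded I.
Proof. exact/bounded_sub/Lambda_subDr. Qed.

Lemma bounded_add I J : bounded I -> bounded J -> bounded (I + J).
Proof.
move=> [b Ib] [c Jc]; exists (b + c) => z [x [y [/Ib xb /Jc yc zxy]]].
by apply: le_trans zxy _; exact: poag_leD.
Qed.

Lemma bounded0 : bounded (0 : L).
Proof. by exists 0. Qed.

Lemma bounded_mulrn n I : bounded I -> bounded (I *+ n).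
Proof.
move=> bI; elim: n => [|n IH]; first exact: bounded0.
by rewrite mulrS; exact: bounded_add.
Qed.

Lemma Lambda_mulrn_le n I z : val (I *+ n) z -> exists2 x, val I x & z <= x *+ n.
Proof.
have [[_ Idir _] I0 _] := LambdaP I.
elim: n z => [|n IH] z; first by exists 0; rewrite // mul0rn.
rewrite mulrS => -[x [y [Ix /IH[x' Ix' yx'] zxy]]].
have [w [Iw xw x'w]] := Idir _ _ Ix Ix'; exists w => //.
apply: le_trans zxy _; rewrite mulrS; apply: poag_leD => //.
by apply: le_trans yx' _; exact: poag_leMn.
Qed.

Lemma Lambda_mulrn n I x : val I x -> val (I *+ n) (x *+ n).
Proof.
move=> Ix; elim: n => [|n IH]; first by rewrite !mulr0n; exact: lexx.
by rewrite !mulrS; exists x, (x *+ n).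
Qed.

Lemma Lambda_cancel K I J : bounded K -> I + K = J + K -> I = J.
Proof.
move=> bK; have sub I' J' : I' + K = J' + K -> val I' `<=` val J'.
  move=> E; have [hJ _ cJ] := LambdaP J'; apply: (near_sub hG hJ cJ) => k.
  have [_ K0 _] := LambdaP K.
  apply: (near_cancel hG hJ _ bK); first by exists 0.
  apply: (sub_near hG); suff -> : interval_add (val I') (val K) = val (I' + K) by rewrite E.
  by [].
by move=> E; apply/val_inj/seteqP; split; apply: sub.
Qed.

Lemma Lambda_cancell K I J : bounded K -> K + I = K + J -> I = J.
Proof. by move=> bK; rewrite ![K + _]addrC; exact: Lambda_cancel. Qed.

Definition Lambda_cvg p I := set_cvg u (fun n => val (p n)) (val I).

Lemma Lambda_cvg_unique p I J : Lambda_cvg p I -> Lambda_cvg p J -> I = J.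
Proof.
have sub I' J' : Lambda_cvg p I' -> Lambda_cvg p J' -> val I' `<=` val J'.
  move=> pI pJ; have [hJ _ cJ] := LambdaP J'; apply: (near_sub hG hJ cJ) => k.
  have [N hN] := pI k.+1; have [M hM] := pJ k.+1.
  exact: (near_trans hG (hN _ (leq_maxl N M)).2 (hM _ (leq_maxr N M)).1).
by move=> pI pJ; apply/val_inj/seteqP; split; apply: sub.
Qed.

Lemma Lambda_cvg_cst I : Lambda_cvg (fun=> I) I.
Proof. by move=> k; exists 0%N => n _; split; exact: (sub_near hG). Qed.

Lemma Lambda_cvgD p q I J : Lambda_cvg p I -> Lambda_cvg q J ->
  Lambda_cvg (fun n => p n + q n) (I + J).
Proof.
move=> pI qJ k; have [N hN] := pI k.+1; have [M hM] := qJ k.+1.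
exists (maxn N M) => n; rewrite geq_max => /andP[/hN[h1 h2] /hM[h3 h4]].
by split; exact: (near_add hG).
Qed.

Lemma Lambda_cvgMn m p I : Lambda_cvg p I -> Lambda_cvg (fun n => p n *+ m) (I *+ m).
Proof.
move=> pI; elim: m => [|m IH]; first exact: Lambda_cvg_cst.
rewrite mulrS; under [X in Lambda_cvg X]eq_fun do rewrite mulrS.
exact: Lambda_cvgD.
Qed.

Lemma Lambda_cvg_shift m p I : Lambda_cvg p I -> Lambda_cvg (fun n => p (m + n)%N) I.
Proof.
move=> pI k; have [N hN] := pI k; exists N => n Nn; apply: hN.
exact: leq_trans Nn (leq_addl _ _).
Qed.

Lemma Lambda_cvg_cauchy p I : Lambda_cvg p I -> set_cauchy u (fun n => val (p n)).
Proof.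
move=> pI k; have [N hN] := pI k.+1; exists N => m n /hN[h1 _] /hN[_ h2].
exact: (near_trans hG h1 h2).
Qed.

Lemma Lambda_complete p : set_cauchy u (fun n => val (p n)) -> exists I, Lambda_cvg p I.
Proof.
move=> cp; have pint n : interval (val (p n)) by case: (LambdaP (p n)).
have p0 n : val (p n) 0 by case: (LambdaP (p n)).
have limP : set_lim u (fun n => val (p n)) \in closed_pos_interval R u.
  apply/asboolP; split; [exact: (set_lim_interval hG)|exact: (set_lim0 hG)|].
  exact: (set_lim_closed hG).
by exists (Sub (set_lim u (fun n => val (p n))) limP : L); exact: (set_lim_cvg hG).
Qed.

Lemma Lambda_cvg_bounded p I : Lambda_cvg p I -> (forall n, bounded (p n)) -> bounded I.
Proof.
move=> /(_ 0%N)[N /(_ N (leqnn _))[_ Ip]] /(_ N)[b pb].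
exists (u + b) => x /Ip[h /pb hb]; rewrite /small expn0 mulr1n poag_lerBlDr => xh.
by apply: le_trans xh _; exact: poag_leD.
Qed.

(** The complements [r n], with [q n + r n = p n], form a Cauchy sequence because
[r m + q n] is close to [r m + q m = p m], which is close to [p n = r n + q n],
and [q n] can be cancelled. *)
Lemma Lambda_cvg_alg_le p q I J : (forall n, bounded (q n)) ->
  Lambda_cvg p I -> Lambda_cvg q J -> (forall n, alg_le (q n) (p n)) -> alg_le J I.
Proof.
move=> bq pI qJ /choice[r hr].
have [|K rK] := @Lambda_complete r; last first.
  exists K; apply: Lambda_cvg_unique (Lambda_cvgD qJ rK) _.
  by have -> : (fun n => q n + r n) = p by exact/funext.
move=> k; have [N hN] := Lambda_cvg_cauchy pI k.+2.
have [M hM] := Lambda_cvg_cauchy qJ k.+3.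
exists (maxn N M) => m n; rewrite !geq_max => /andP[Nm Mm] /andP[Nn Mn].
have [hr0 r0 _] := LambdaP (r n); have [_ qn0 _] := LambdaP (q n).
apply: (near_cancel hG hr0 _ (bq n)); first by exists 0.
apply: (near_trans hG (J := val (p m))).
  rewrite -hr addrC; apply: (near_add hG); first exact: (sub_near hG).
  exact: hM.
suff -> : interval_add (val (r n)) (val (q n)) = val (p n) by exact: hN.
by rewrite -[LHS]/(val (r n + q n)) addrC hr.
Qed.

Let div_subproof k I : [set g | val I (g *+ 2 ^ k)] \in closed_pos_interval R u.
Proof.
have [hJ I0 cI] := LambdaP I; have [_ Idir Ilow] := hJ; apply/asboolP; split.
- split; [by exists 0; rewrite /= mul0rn | |]; last first.
    by move=> x y xy; apply: Ilow; exact: poag_leMn.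
  move=> x y Ix Iy; have [w [Iw xw yw]] := Idir _ _ Ix Iy.
  have [s [xs ys sw]] := interpolate_div hU hI xw yw.
  by exists s; split=> //; exact: Ilow sw Iw.
- by rewrite /= mul0rn.
apply: (near_norm_closed hG) => z hz; apply: (norm_closed_near hG hJ cI) => j.
have [h Ih zh] := hz (k + j)%N; exists (h *+ 2 ^ k) => //.
by rewrite -mulrnBl /small -mulrnA -expnD.
Qed.

(** If [G] is the group of integers, the half-line below [n] goes to the half-line
below the integer part of [n / 2 ^ k]. *)
Definition Lambda_div k I : L := Sub [set g | val I (g *+ 2 ^ k)] (div_subproof k I).

(** If [x] is in [I] and [2 ^ k c] in [K], then [2 ^ k (x + c) <= 2 ^ k y + s] for
some [y] in [J] and [s] in [K'], so [2 ^ k (x + c - y)] is in [K']: thus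
[x + c - y] itself witnesses the inclusion. *)
Lemma Lambda_div_eq k I J K K' : I *+ 2 ^ k + K = J *+ 2 ^ k + K' ->
  I + Lambda_div k K = J + Lambda_div k K'.
Proof.
have sub I1 J1 K1 K2 : I1 *+ 2 ^ k + K1 = J1 *+ 2 ^ k + K2 ->
    val (I1 + Lambda_div k K1) `<=` val (J1 + Lambda_div k K2).
  move=> E z [x [c [Ix Kc zxc]]].
  have : val (J1 *+ 2 ^ k + K2) (x *+ 2 ^ k + c *+ 2 ^ k).
    by rewrite -E; exists (x *+ 2 ^ k), (c *+ 2 ^ k); split=> //; exact: Lambda_mulrn.
  move=> [y' [s [/Lambda_mulrn_le[y Jy y'y] Ks xcy]]].
  exists y, (x + c - y); split=> //; last by rewrite addrC subrK.
  have [[_ _ Klow] _ _] := LambdaP K2; apply: Klow Ks.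
  rewrite mulrnBl poag_lerBlDr mulrnDl [leRHS]addrC; apply: le_trans xcy _.
  exact: poag_leD.
by move=> E; apply/val_inj/seteqP; split; apply: sub.
Qed.

Lemma Lambda_div_small (b : G) : exists j, forall k I, (forall x, val I x -> x <= b) ->
  forall g, val (Lambda_div (k + j) I) g -> small k g.
Proof.
by have [j hj] := bounded_small hG b; exists j => k I Ib g /Ib; exact: hj.
Qed.

Lemma Lambda_div_bounded k I : bounded I -> bounded (Lambda_div k I).
Proof.
move=> [b Ib]; have [s [bs s0 _]] : exists s, [/\ b <= s, 0 <= s & True].
  have [u0 /(_ b)[n _ bn]] := acdg_unit hG.
  by exists (u *+ n); split=> //; exact: poag_ge0Mn.
exists s => g /Ib gb; apply: (unperforated_le hU (n := 2 ^ k)); first by rewrite expn_gt0.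
apply: le_trans gb (le_trans bs _).
have : (0 < 2 ^ k)%N by rewrite expn_gt0.
case: (2 ^ k)%N => // n _; rewrite mulrS -[leLHS]addr0 poag_leD //.
exact: poag_ge0Mn.
Qed.

Lemma Lambda_div_cvg0 I : bounded I -> Lambda_cvg (fun k => Lambda_div k I) 0.
Proof.
move=> [b Ib] k; have [j hj] := Lambda_div_small b; exists (k + j)%N => n kn; split.
  move=> g Ig; exists 0; first exact: lexx.
  rewrite subr0; apply: (@small_leq _ _ _ hG k (n - j)%N).
    by rewrite leq_subRL ?(leq_trans (leq_addl k j)) // addnC.
  apply: (hj _ I) => //; rewrite subnK // (leq_trans (leq_addl k j)) //.
apply: (sub_near hG) => z z0; have [[_ _ Ilow] I0 _] := LambdaP (Lambda_div n I).
exact: Ilow z0 I0.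
Qed.

(** The terms decay geometrically, so the partial sums form a Cauchy sequence. *)
Lemma Lambda_series_cvg p (b : G) : (forall n x, val (p n) x -> x *+ 2 ^ n <= b) ->
  exists I, Lambda_cvg (fun n => \sum_(i < n) p i) I.
Proof.
move=> pb; have [j hj] := bounded_small hG b.
(* the first term has order [k.+1], the others form a tail of order [k.+1] *)
have tail m k x : val (\sum_(i < m) p (k + j + i).+1) x -> small k x.
  elim: m k x => [|m IH] k x.
    by rewrite big_ord0 => x0; apply: small_le x0 (small0 hG k).
  rewrite big_ord_recl /= => -[y [z [py sz xyz]]].
  apply: small_le xyz _; apply: (smallD hG).
    by move: py; rewrite addn0 -addSn => /pb; exact: hj.
  apply: (IH k.+1); rewrite (eq_bigr (fun i : 'I_m => p (k.+1 + j + i).+1)) in sz => //.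
  by move=> i _; rewrite /bump /= add1n addnS !addSn.
pose P n := \sum_(i < n) p i.
have Psplit m n : P (m + n)%N = P m + \sum_(i < n) p (m + i)%N.
  by rewrite /P big_split_ord.
apply: Lambda_complete => k; exists (k + j).+1 => m n /subnKC <- /subnKC <-.
rewrite -!/(P _) !Psplit => z [x [y [Px Sy zxy]]].
exists x; first exact: Lambda_subDr.
by apply: (small_le _ (tail _ _ _ Sy)); rewrite poag_lerBlDr addrC.
Qed.

End LambdaTheory.

(** * The Grothendieck group *)

Section MclTheory.
Variables (R : realType) (G : poagType) (u : G).
Variable hG : arch_complete_dimension_group R u.
Local Notation L := (Lambda_cl_pos hG).
Local Notation bounded I := (interval_bounded (val I)).

(** The hypothesis reads [x - y = a - b] in the universal group, and the two
relations say that [n (x - y) + h1 - h2] and [n (a - b) + h1 - h2] are positive. *)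
Lemma alg_le_shift (x y a b h1 h2 : L) n : bounded y ->
  x + b = a + y ->
  alg_le (y *+ n + h2) (x *+ n + h1) -> alg_le (b *+ n + h2) (a *+ n + h1).
Proof.
move=> hy E [r hr]; exists r; apply: (Lambda_cancell (bounded_mulrn n hy)).
rewrite addrA [X in X + r = _]addrCA -addrA hr !addrA -mulrnDl [b + x]addrC E.
by rewrite [a + y]addrC mulrnDl.
Qed.

(** Positivity of [n f + h1 - h2] passes to limits in [f]. Here
[x m - y m = x0 - y0 + P m - Q m] tends to [f1 - f2 = x0 - y0 + Pl - Ql]; since
only [P] and [Q] are known to converge as intervals, the relation is first
rewritten in terms of them. *)
Lemma alg_le_limit (x y P Q : nat -> L) (x0 y0 Pl Ql f1 f2 h1 h2 : L) n K :
  (forall m, bounded (y m)) -> (forall m, bounded (Q m)) ->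
  bounded y0 -> bounded h2 ->
  Lambda_cvg P Pl -> Lambda_cvg Q Ql ->
  (forall m, x m + (y0 + Q m) = (x0 + P m) + y m) ->
  (x0 + Pl) + f2 = f1 + (y0 + Ql) ->
  (forall m, (K <= m)%N -> alg_le (y m *+ n + h2) (x m *+ n + h1)) ->
  alg_le (f2 *+ n + h2) (f1 *+ n + h1).
Proof.
move=> by_ bQ by0 bh2 cP cQ E Ef hle.
have bQl : bounded Ql by exact: Lambda_cvg_bounded cQ bQ.
apply: alg_le_shift Ef _; first exact: bounded_add.
apply: (@Lambda_cvg_alg_le _ _ _ hG (fun m => (x0 + P (K + m)%N) *+ n + h1)
    (fun m => (y0 + Q (K + m)%N) *+ n + h2)).
- by move=> m; apply: bounded_add bh2; apply/bounded_mulrn/bounded_add.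
- apply: Lambda_cvgD (Lambda_cvg_cst _); apply: Lambda_cvgMn.
  by apply: Lambda_cvgD (Lambda_cvg_cst _) _; exact: Lambda_cvg_shift.
- apply: Lambda_cvgD (Lambda_cvg_cst _); apply: Lambda_cvgMn.
  by apply: Lambda_cvgD (Lambda_cvg_cst _) _; exact: Lambda_cvg_shift.
- by move=> m; apply: alg_le_shift (E _) (hle _ (leq_addr _ _)).
Qed.

Variable d : L.
Hypothesis hd : bounded d.

Lemma restr_bounded (x : M0_cl d) : bounded (val x).
Proof.
have /asboolP[n _ [z xz]] := valP x.
by apply: (@bounded_addl _ _ _ hG _ z); rewrite xz; exact: bounded_mulrn.
Qed.

Lemma M0_cl_cancellative : cancellative (M0_cl d).
Proof.
move=> x y z E; apply/val_inj; apply: Lambda_cancel (restr_bounded z) _.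
by rewrite -!raddfD E.
Qed.

Lemma restr_alg_le (x : M0_cl d) (y : L) : alg_le y (val x) -> y \in restr_pred d.
Proof.
move=> [z yz]; have /asboolP[n n0 [t xt]] := valP x; apply/asboolP; exists n => //.
by exists (z + t); rewrite addrA yz.
Qed.

(** A complement of [val y] in [val x] is below [val x], hence automatically an
element of [M0_cl d]. *)
Lemma M_cl_ge0 (x y : M0_cl d) :
  (0 <= grot_class x - grot_class y :> M_cl d) <-> alg_le (val y) (val x).
Proof.
split=> [/grot_ge0[t /eqP]|[t E]].
  rewrite subr_eq -grot_classD => /eqP/grot_class_eq[c /M0_cl_cancellative ->].
  by exists (val t); rewrite raddfD addrC.
have tP : t \in restr_pred d by apply: (@restr_alg_le x); exists (val y); rewrite addrC.
apply/grot_ge0; exists (Sub t tP : M0_cl d).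
apply/eqP; rewrite subr_eq -grot_classD; apply/eqP; congr grot_class.
by apply: val_inj; rewrite raddfD /= addrC.
Qed.

Lemma grot_classMn (x : M0_cl d) n : grot_class (x *+ n) = grot_class x *+ n.
Proof.
elim: n => [|n IH]; first by rewrite !mulr0n grot_class0.
by rewrite !mulrS grot_classD IH.
Qed.

Lemma M_cl_archimedean : archimedean (M_cl d).
Proof.
move=> a b hab; have [x [y aE]] := grot_classB a; have [z [w bE]] := grot_classB b.
suff : alg_le (val x) (val y).
  by rewrite -M_cl_ge0 -opprB -aE -poag_leN opprK oppr0.
have div_le k : alg_le (val x) (val y + Lambda_div k (val z)).
  have := hab (2 ^ k)%N; rewrite -poag_subr_ge0.
  have -> : b - a *+ 2 ^ k = grot_class (z + y *+ 2 ^ k) - grot_class (w + x *+ 2 ^ k).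
    rewrite aE bE mulrnBl opprB addrACA -opprD.
    by rewrite !grot_classD !grot_classMn.
  move=> /M_cl_ge0[t]; rewrite !raddfD !raddfMn => ht.
  have : val x *+ 2 ^ k + (val w + t) = val y *+ 2 ^ k + val z.
    by rewrite addrCA addrA ht addrC.
  by move=> /Lambda_div_eq E; exists (Lambda_div k (val w + t)).
have bz : bounded (val z) by exact: restr_bounded.
have := @Lambda_cvg_alg_le _ _ _ hG (fun k => val y + Lambda_div k (val z)) (fun=> val x)
  (val y + 0) (val x) (fun=> restr_bounded x)
  (Lambda_cvgD (Lambda_cvg_cst _) (Lambda_div_cvg0 bz)) (Lambda_cvg_cst _) div_le.
by rewrite addr0.
Qed.

Lemma M_cl_close (x y a b : M0_cl d) n :
  - M_cl_unit d <= ((grot_class x - grot_class y) - (grot_class a - grot_class b)) *+ n <->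
  alg_le ((val y + val a) *+ n) ((val x + val b) *+ n + d).
Proof.
rewrite -poag_subr_ge0 opprK.
have -> : ((grot_class x - grot_class y) - (grot_class a - grot_class b)) *+ n
      + M_cl_unit d
    = grot_class ((x + b) *+ n + restr_unit d) - grot_class ((y + a) *+ n).
  rewrite opprB addrACA [- _ - _]addrC [X in (_ + X) *+ n]addrC -opprD mulrnBl addrAC.
  by rewrite !grot_classD !grot_classMn !grot_classD.
have := M_cl_ge0 ((x + b) *+ n + restr_unit d) ((y + a) *+ n).
by rewrite !raddfD !raddfMn !raddfD.
Qed.

(** The limit is built from the sums of the increments of a fast subsequence, and
exists in [M_cl d] because the difference of these sums is within [d] of [0]. *)
Lemma M_cl_complete : norm_complete R (M_cl_unit d).
Proof.
move=> f fcauchy.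
have hU : unperforated (M_cl d).
  exact: archimedean_unperforated (Grot_unitP d) M_cl_archimedean.
have /choice[XY fE] n : exists ab : M0_cl d * M0_cl d,
    f n = grot_class ab.1 - grot_class ab.2.
  by have [a [b ->]] := grot_classB (f n); exists (a, b).
pose x n : L := val (XY n).1; pose y n : L := val (XY n).2.
have [phi [phi_le close]] : exists phi : nat -> nat,
    {homo phi : j k / (j <= k)%N} /\
    forall k m n, (phi k <= m)%N -> (phi k <= n)%N ->
      alg_le ((y m + x n) *+ 2 ^ k) ((x m + y n) *+ 2 ^ k + d).
  apply: (@monotone_modulus (fun k m n =>
    alg_le ((y m + x n) *+ 2 ^ k) ((x m + y n) *+ 2 ^ k + d))) => k.
  have [|N hN] := fcauchy (2 ^ k)%:R^-1; first by rewrite invr_gt0 ltr0n expn_gt0.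
  exists N => m n Nm Nn; apply/M_cl_close; rewrite -!fE.
  have := order_norm_lt hU (Grot_unitP d) _ (hN _ _ Nm Nn).
  by rewrite expn_gt0 => /(_ isT)[].
have bx n : bounded (x n) by exact: restr_bounded.
have by_ n : bounded (y n) by exact: restr_bounded.
pose xs k := x (phi k); pose ys k := y (phi k).
have bxs k : bounded (xs k) by exact: bx.
have bys k : bounded (ys k) by exact: by_.
have /choice[v hv] k : exists w : L,
    (ys k.+1 + xs k) *+ 2 ^ k + w = (xs k.+1 + ys k) *+ 2 ^ k + d.
  by apply: close => //; exact: phi_le.
(* [v k] is [d] plus a multiple of an increment; [w] is [d] minus the same multiple *)
have vd k : val (v k) `<=` val (d + d).
  have [w hw] : alg_le ((ys k + xs k.+1) *+ 2 ^ k) ((xs k + ys k.+1) *+ 2 ^ k + d).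
    by apply: close => //; exact: phi_le.
  suff <- : v k + w = d + d by exact: Lambda_subDr.
  have b1 : bounded ((ys k.+1 + xs k) *+ 2 ^ k) by apply/bounded_mulrn/bounded_add.
  apply: (Lambda_cancell b1); rewrite addrA hv.
  rewrite addrAC [xs k.+1 + _]addrC hw [xs k + _]addrC -addrA.
  by [].
pose p k := Lambda_div k (v k); pose q k := Lambda_div k d.
pose P n := \sum_(i < n) p i; pose Q n := \sum_(i < n) q i.
have pq k : xs k.+1 + ys k + q k = ys k.+1 + xs k + p k.
  by apply: Lambda_div_eq; rewrite hv.
have bv k : bounded (v k) by exact: bounded_sub (vd k) (bounded_add hd hd).
have bP n : bounded (P n).
  by rewrite /P; elim/big_ind: _ => //; [exact: bounded0 | exact: bounded_add
    | move=> i _; exact: Lambda_div_bounded].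
have bQ n : bounded (Q n).
  by rewrite /Q; elim/big_ind: _ => //; [exact: bounded0 | exact: bounded_add
    | move=> i _; exact: Lambda_div_bounded].
have PQ m : xs m + (ys 0%N + Q m) = (xs 0%N + P m) + ys m.
  elim: m => [|m IH]; first by rewrite /P /Q !big_ord0 !addr0.
  have b1 : bounded (xs m + ys m) by exact: bounded_add.
  apply: (Lambda_cancell b1).
  rewrite /P /Q !big_ord_recr /= -/(P m) -/(Q m).
  transitivity ((xs m + (ys 0%N + Q m)) + (xs m.+1 + ys m + q m)).
    by rewrite !addrA [LHS](ACl (1*4*5*3*2*6)).
  by rewrite IH pq !addrA [LHS](ACl (5*3*1*2*6*4)).
have [b0 hb0] := bounded_add hd hd.
have [Pl cP] : exists I, Lambda_cvg P I.
  by apply: (@Lambda_series_cvg _ _ _ hG p b0) => n g pg; exact: hb0 (vd _ _ pg).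
have [Ql cQ] : exists I, Lambda_cvg Q I.
  apply: (@Lambda_series_cvg _ _ _ hG q b0) => n g qg.
  exact: (hb0 _ (@Lambda_subDr _ _ _ hG d d _ qg)).
have bPl : bounded Pl by exact: Lambda_cvg_bounded cP bP.
have bQl : bounded Ql by exact: Lambda_cvg_bounded cQ bQ.
have QP m : ys m + (xs 0%N + P m) = (ys 0%N + Q m) + xs m.
  by rewrite addrC -PQ addrC.
have [F hF] : alg_le Ql (Pl + d).
  apply: (Lambda_cvg_alg_le bQ (Lambda_cvgD cP (Lambda_cvg_cst d)) cQ) => m.
  have := @alg_le_shift (xs m + ys 0%N) (ys m + xs 0%N) (P m) (Q m) d 0 1.
  rewrite !mulr1n !addr0; apply; first exact: bounded_add.
    by rewrite -addrA PQ [xs 0%N + _]addrC -addrA [xs 0%N + _]addrC.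
  by have := close 0%N (phi m) (phi 0%N) (phi_le _ _ (leq0n m)) (leqnn _); rewrite !mulr1n.
have [F' hF'] : alg_le Pl (Ql + d).
  apply: (Lambda_cvg_alg_le bP (Lambda_cvgD cQ (Lambda_cvg_cst d)) cP) => m.
  have := @alg_le_shift (ys m + xs 0%N) (xs m + ys 0%N) (Q m) (P m) d 0 1.
  rewrite !mulr1n !addr0; apply; first exact: bounded_add.
    by rewrite -addrA QP [ys 0%N + _]addrC -addrA [ys 0%N + _]addrC.
  have := close 0%N (phi 0%N) (phi m) (leqnn _) (phi_le _ _ (leq0n m)).
  by rewrite !mulr1n [_ + x _]addrC [_ + y _]addrC.
(* [F] and [F'] stand for [d + (Pl - Ql)] and [d - (Pl - Ql)] *)
have FF' : F + F' = d + d.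
  apply: (Lambda_cancell (bounded_add bPl bQl)).
  by rewrite [X in X + (F + F')]addrC addrACA hF hF' addrACA.
have FP : F \in restr_pred d.
  by apply/asboolP; exists 2%N => //; exists F'; rewrite FF'.
pose f1 : M0_cl d := (XY (phi 0%N)).1 + Sub F FP.
pose f2 : M0_cl d := (XY (phi 0%N)).2 + restr_unit d.
have f1E : val f1 = xs 0%N + F by rewrite raddfD.
have f2E : val f2 = ys 0%N + d by rewrite raddfD.
have lim12 : (xs 0%N + Pl) + val f2 = val f1 + (ys 0%N + Ql).
  by rewrite f1E f2E [ys 0%N + d]addrC [LHS]addrA
    -[_ + Pl + d]addrA -hF !addrA [LHS](ACl (1*3*4*2)).
have lim21 : (ys 0%N + Ql) + val f1 = val f2 + (xs 0%N + Pl).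
  by rewrite addrC -lim12 addrC.
exists (grot_class f1 - grot_class f2) => e /small_pow2[k hk].
exists (phi k) => n kn.
have swap (a b : L) : alg_le ((y n + a) *+ 2 ^ k) ((x n + b) *+ 2 ^ k + d) =
    alg_le (a *+ 2 ^ k + y n *+ 2 ^ k) (b *+ 2 ^ k + (x n *+ 2 ^ k + d)).
  by rewrite addrA -!mulrnDl [y n + _]addrC [x n + _]addrC.
have swap' (a b : L) : alg_le ((a + x n) *+ 2 ^ k) ((b + y n) *+ 2 ^ k + d) =
    alg_le (a *+ 2 ^ k + x n *+ 2 ^ k) (b *+ 2 ^ k + (y n *+ 2 ^ k + d)).
  by rewrite addrA -!mulrnDl.
apply: le_lt_trans hk; apply: order_norm_le.
- by rewrite expn_gt0.
- rewrite fE; apply/M_cl_close; rewrite swap.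
  apply: (alg_le_limit (K := k) bxs bP (bxs 0%N) _ cQ cP QP lim21) => [|m km].
    exact: bounded_mulrn.
  by rewrite -swap; apply: close => //; exact: phi_le.
- rewrite -poag_leN -mulNrn opprB fE; apply/M_cl_close; rewrite swap'.
  apply: (alg_le_limit (K := k) bys bQ (bys 0%N) _ cP cQ PQ lim12) => [|m km].
    exact: bounded_mulrn.
  by rewrite -swap'; apply: close => //; exact: phi_le.
Qed.

End MclTheory.

Theorem theorem3p10 (R : realType) (G : poagType) (u : G)
    (hG : arch_complete_dimension_group R u)
    (d : Lambda_cl_pos hG) (hd : interval_bounded (val d)) :
  [/\ cancellative (M0_cl d), archimedean (M_cl d)
    & norm_complete R (M_cl_unit d)].
Proof.
split; first exact: M0_cl_cancellative.
  exact: M_cl_archimedean.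
exact: M_cl_complete.
Qed.
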